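(* Consider the stochastic gradient tracking iteration described in the context with stepsize $\alpha$, under the function, network and gradient-noise assumptions of the context (convex case $\mu=0$), and let $\widetilde F_k=\mathbb{E}[f(\bar x^k)-f(x^\star)]$. If $0<\alpha\le 1/(4L)$, then, for every $k\ge0$, $$\widetilde X_{k+1}\le\widetilde X_k-\alpha\widetilde F_k+\frac{3\alpha L}{2}\widetilde E_k+\frac{\alpha^2\sigma^2}{N},$$ $$E_{k+1}\le E_k-\frac{\delta}{4}\widetilde E_k+\frac{20\alpha^2QL}{\delta}\widetilde F_k+\frac{10\alpha^2QL^2}{\delta}\widetilde E_k+\alpha^2Q\sigma^2 .$$
   Context: **Problem and algorithm.** $N,d\ge1$ are integers; agent $i\in\{1,\dots,N\}$ has a differentiable objective $f_i:\mathbb{R}^d\to\mathbb{R}$, $f_i(x)=\mathbb{E}[F_i(x;\xi_i)]$, and $f=\frac1N\sum_{i=1}^N f_i$. $\nabla F_i(x;\xi)$ is the stochastic gradient in $x$. Given mixing matrices $W_k=(w_{ij}^k)\in\mathbb{R}^{N\times N}$, stepsize $\alpha>0$, initial points $x_i^0\in\mathbb{R}^d$ and $g_i^0=\nabla F_i(x_i^0;\xi_i^0)$, stochastic gradient tracking is, for $k\ge0$, $$x_i^{k+1}=\sum_{j=1}^N w_{ij}^k(x_j^k-\alpha g_j^k),\qquad g_i^{k+1}=\sum_{j=1}^N w_{ij}^k g_j^k+\nabla F_i(x_i^{k+1};\xi_i^{k+1})-\nabla F_i(x_i^k;\xi_i^k).$$ **Function assumption (convex case).** Each $f_i$ is convex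 and $L$-smooth (gradient $L$-Lipschitz), $L>0$. $f$ admits a minimizer; $x^\star$ is any (fixed) minimizer of $f$. **Network assumption.** $\{W_k\}_{k\ge0}$ is deterministic and each $W_k$ is nonnegative and doubly stochastic ($W_k\mathbf 1=\mathbf 1$, $\mathbf 1^{\mathsf T}W_k=\mathbf 1^{\mathsf T}$). With $\Pi=\frac1N\mathbf 1\mathbf 1^{\mathsf T}$ and $\widetilde W_k=W_k-\Pi$, there are an integer $\tau\ge1$ and $\lambda\in[0,1)$ with $\|\widetilde W_{k+\tau-1}\cdots\widetilde W_k\|_2\le\lambda$ for all $k\ge0$. Let $\Delta_\lambda=1-\lambda$. **Gradient-noise assumption.** $\mathcal F^k$ is the information ($\sigma$-algebra) available immediately before the samples $\xi_1^k,\dots,\xi_N^k$ are drawn; it contains the initialization and all iterates and samples generated up to iteration $k-1$ (so $x_i^k$ is $\mathcal F^k$-measurable). Conditioned on $\mathcal F^k$, the samples $\xi_1^k,\dots,\xi_N^k$ are mutually independent and, for every $i$, $\mathbb{E}[\nabla F_i(x_i^k;\xi_i^k)-\nabla f_i(x_i^k)\mid\mathcal F^k]=0$ and $\mathbb{E}[\|\nabla F_i(x_i^k;\xi_i^k)-\nabla f_i(x_i^k)\|^2\mid\mathcal F^k]\le\sigma^2$. The initial iterates $x_i^0$ are deterministic. **Notation.** Stack $\mathbf x^k=\mathrm{col}\{x_1^k,\dots,x_N^k\}$, $\mathbf g^k=\mathrm{col}\{g_i^k\}$, $\nabla\mathbf F(\mathbf x^k;\boldsymbol\xi^k)=\mathrm{col}\{\nabla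 F_i(x_i^k;\xi_i^k)\}$, $\nabla\mathbf f(\mathbf x)=\mathrm{col}\{\nabla f_i(x_i)\}$ in $\mathbb{R}^{Nd}$; $\mathbf x^\star=\mathbf 1\otimes x^\star$; $\mathbf\Pi=\Pi\otimes I_d$; $\widetilde{\mathbf W}_k=\widetilde W_k\otimes I_d$; $\bar x^k=\frac1N\sum_i x_i^k$; $\widehat{\mathbf x}^k=(\mathbf I-\mathbf\Pi)\mathbf x^k$; $\mathbf y^k=\mathbf g^k-\nabla\mathbf F(\mathbf x^k;\boldsymbol\xi^k)$; $\widetilde{\mathbf y}^k=\mathbf y^k+\nabla\mathbf f(\mathbf x^\star)$; $\eta=\frac{\Delta_\lambda}{2\tau}$; $\mathbf z^k=\frac{\alpha}{\eta}\widetilde{\mathbf y}^k$; $\delta=\frac{1-\lambda^2}{\tau}$; $Q=1+\frac{8}{\eta^2}=1+\frac{32\tau^2}{\Delta_\lambda^2}$. Let $\mathbf R_k=\delta\sum_{r=0}^\infty\mathbf\Psi(k+r,k)^{\mathsf T}\mathbf\Psi(k+r,k)$ with $\mathbf\Psi(t,s)=\widetilde{\mathbf W}_{t-1}\cdots\widetilde{\mathbf W}_s$ for $t>s$, $\mathbf\Psi(s,s)=\mathbf I$ (the series converges under the network assumption), and $\|\mathbf q\|_{\mathbf R}^2=\mathbf q^{\mathsf T}\mathbf R\mathbf q$. Define $$\widetilde X_k=\mathbb{E}\|\bar x^k-x^\star\|^2,\quad E_k=\tfrac1N\mathbb{E}\bigl[\|\widehat{\mathbf x}^k\|_{\mathbf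 R_k}^2+2\|\mathbf z^k\|_{\mathbf R_k}^2\bigr],\quad \widetilde E_k=\tfrac1N\mathbb{E}\bigl[\|\widehat{\mathbf x}^k\|^2+2\|\mathbf z^k\|^2\bigr].$$ *)

(* Defs.v *)
From HB Require Import structures.
From mathcomp Require Import all_boot all_order all_algebra.
From mathcomp Require Import all_classical all_reals all_analysis.
From mathcomp.real_closed Require Import mxtens.

Set Implicit Arguments.
Unset Strict Implicit.
Unset Printing Implicit Defensive.

Import Order.TTheory GRing.Theory Num.Theory.
Import numFieldNormedType.Exports.

Local Open Scope classical_set_scope.
Local Open Scope ring_scope.

(* The library norm on matrices is the max norm (it only provides the
   topology); [enorm] is the Euclidean norm. *)
Definition enorm (R : realType) n (v : 'cV[R]_n) : R :=
  Num.sqrt (\sum_(i < n) v i 0 ^+ 2).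

Definition opnorm2 (R : realType) m n (A : 'M[R]_(m, n)) : R :=
  sup [set enorm (A *m v) | v in [set v : 'cV[R]_n | enorm v <= 1]].

(* squared [M]-seminorm of [q] *)
Definition qform (R : realType) n (M : 'M[R]_n) (q : 'cV[R]_n) : R :=
  (q^T *m M *m q) 0 0.

Definition grad (R : realType) d (f : 'cV[R]_d -> R^o) (x : 'cV[R]_d) :
    'cV[R]_d :=
  \col_(j < d) 'D_(delta_mx j 0) f x.

Section Probability.
Context (R : realType) (dO : measure_display) (Omega : measurableType dO)
  (P : probability Omega R).

Definition sub_sigma_field (G : set (set Omega)) : Prop :=
  sigma_algebra setT G /\ G `<=` measurable.

Definition measurable_wrt (G : set (set Omega)) dT (T : measurableType dT)
    (X : Omega -> T) : Prop :=
  measurable_fun setT (X : g_sigma_algebraType G -> T).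

Definition vmeasurable_wrt (G : set (set Omega)) d
    (X : Omega -> 'cV[R]_d) : Prop :=
  forall j, measurable_wrt G (fun w => X w j 0).

(* [Y] is a version of the conditional expectation E[X | G] *)
Definition is_cond_exp (G : set (set Omega)) (X Y : Omega -> R) : Prop :=
  [/\ P.-integrable setT (EFin \o X),
      measurable_wrt G Y,
      P.-integrable setT (EFin \o Y) &
      forall A, G A -> (\int[P]_(w in A) (Y w)%:E = \int[P]_(w in A) (X w)%:E)%E].

(* Mutual independence of the finite family [X] conditionally on [G];
   taking some [B i] to be [setT] yields the product rule for subfamilies. *)
Definition cond_mutual_indep (G : set (set Omega)) (I : finType)
    (dT : I -> measure_display) (T : forall i, measurableType (dT i))
    (X : forall i, Omega -> T i) : Prop :=
  forall B : forall i, set (T i), (forall i, measurable (B i)) ->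
  exists p : I -> Omega -> R,
    (forall i, is_cond_exp G \1_(X i @^-1` B i) (p i)) /\
    is_cond_exp G \1_(\bigcap_(i in [set: I]) (X i @^-1` B i))
      (fun w => \prod_(i : I) p i w).

End Probability.

Definition doubly_stochastic (R : realType) N (W : 'M[R]_N) : Prop :=
  [/\ forall i j, 0 <= W i j,
      W *m const_mx 1 = const_mx 1 :> 'cV[R]_N &
      const_mx 1 *m W = const_mx 1 :> 'rV[R]_N].

Definition avgmx (R : realType) N : 'M[R]_N := const_mx (N%:R^-1).

Definition wtilde (R : realType) N (W : nat -> 'M[R]_N) (k : nat) : 'M[R]_N :=
  W k - avgmx R N.

(* [A (t-1) *m ... *m A s], and the identity when [t = s] *)
Definition mxchain (R : realType) n (A : nat -> 'M[R]_n) (t s : nat) : 'M[R]_n :=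
  \big[mulmx/1%:M]_(i <- rev (index_iota s t)) A i.

(* [*t] is the Kronecker product *)
Definition lift_mx (R : realType) N d (A : 'M[R]_N) : 'M[R]_(N * d) :=
  A *t (1%:M : 'M[R]_d).

(* [mxtens_unindex p = (p %/ d, p %% d)] is the indexing used by [*t], so this
   is col{v_1, ..., v_N} *)
Definition stack (R : realType) N d (v : 'I_N -> 'cV[R]_d) : 'cV[R]_(N * d) :=
  \col_(p < N * d) v (mxtens_unindex p).1 (mxtens_unindex p).2 0.

Definition avg (R : realType) N d (v : 'I_N -> 'cV[R]_d) : 'cV[R]_d :=
  N%:R^-1 *: \sum_(i < N) v i.

Section Constants.
Context (R : realType) (tau : nat) (lambda : R).
Definition eta : R := (1 - lambda) / (2 * tau%:R).
Definition delta : R := (1 - lambda ^+ 2) / tau%:R.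
Definition Qconst : R := 1 + 8 / eta ^+ 2.
End Constants.

Definition Rmx (R : realType) N d (W : nat -> 'M[R]_N) (tau : nat) (lambda : R)
    (k : nat) : 'M[R]_(N * d) :=
  let Psi := mxchain (fun l => lift_mx d (wtilde W l)) in
  delta tau lambda *:
    limn (series (fun r => (Psi (k + r)%N k)^T *m Psi (k + r)%N k)).

(* [F i x s] is the sample objective F_i(x; s); [D i] is the law defining
   f_i(x) = E[F_i(x; xi_i)]; the samples themselves are only constrained through
   conditional unbiasedness and variance, not to have law [D i]. *)
Section Objective.
Context (R : realType) (N d : nat) (dX : 'I_N -> measure_display)
  (Xi : forall i, measurableType (dX i)) (D : forall i, probability (Xi i) R)
  (F : forall i, 'cV[R]_d -> Xi i -> R).
Arguments F : clear implicits.

Definition fobj (i : 'I_N) (x : 'cV[R]_d) : R := fine ('E_(D i)[F i x])%E.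

Definition favg (x : 'cV[R]_d) : R := N%:R^-1 * \sum_(i < N) fobj i x.

Definition sgrad (i : 'I_N) (x : 'cV[R]_d) (s : Xi i) : 'cV[R]_d :=
  grad (fun y => F i y s) x.

End Objective.

Section Tracking.
Context (R : realType) (N d : nat) (dX : 'I_N -> measure_display)
  (Xi : forall i, measurableType (dX i)) (D : forall i, probability (Xi i) R)
  (F : forall i, 'cV[R]_d -> Xi i -> R)
  (dO : measure_display) (Omega : measurableType dO) (P : probability Omega R)
  (xi : nat -> forall i, {RV P >-> Xi i})
  (W : nat -> 'M[R]_N) (alpha : R) (x0 : 'I_N -> 'cV[R]_d).

Definition sg (x : nat -> 'I_N -> Omega -> 'cV[R]_d) (k : nat) (i : 'I_N)
    (w : Omega) : 'cV[R]_d :=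
  sgrad F (x k i w) (xi k i w).

Definition noise (x : nat -> 'I_N -> Omega -> 'cV[R]_d) (k : nat) (i : 'I_N)
    (w : Omega) : 'cV[R]_d :=
  sg x k i w - grad (fobj D F i) (x k i w).

Definition gradient_tracking (x g : nat -> 'I_N -> Omega -> 'cV[R]_d) : Prop :=
  [/\ forall i w, x 0%N i w = x0 i,
      forall i w, g 0%N i w = sg x 0%N i w,
      forall k i w, x k.+1 i w =
        \sum_(j < N) W k i j *: (x k j w - alpha *: g k j w) &
      forall k i w, g k.+1 i w =
        \sum_(j < N) W k i j *: g k j w + sg x k.+1 i w - sg x k i w].

Context (tau : nat) (lambda : R) (xs : 'cV[R]_d)
  (x g : nat -> 'I_N -> Omega -> 'cV[R]_d).

Definition xbar (k : nat) (w : Omega) : 'cV[R]_d := avg (fun i => x k i w).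

Definition xhat (k : nat) (w : Omega) : 'cV[R]_(N * d) :=
  (1%:M - lift_mx d (avgmx R N)) *m stack (fun i => x k i w).

Definition ytilde (k : nat) (w : Omega) : 'cV[R]_(N * d) :=
  (stack (fun i => g k i w) - stack (fun i => sg x k i w))
  + stack (fun i => grad (fobj D F i) xs).

Definition zvec (k : nat) (w : Omega) : 'cV[R]_(N * d) :=
  (alpha / eta tau lambda) *: ytilde k w.

(* The expectations are extended real numbers, so that no finiteness is
   presupposed. *)
Definition Xtilde (k : nat) : \bar R :=
  'E_P[fun w => (enorm (xbar k w - xs) ^+ 2)%R]%E.

Definition Ftilde (k : nat) : \bar R :=
  'E_P[fun w => (favg D F (xbar k w) - favg D F xs)%R]%E.

Definition Ecal (k : nat) : \bar R :=
  ((N%:R^-1)%:E * 'E_P[fun w => (qform (Rmx d W tau lambda k) (xhat k w)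
     + 2 * qform (Rmx d W tau lambda k) (zvec k w))%R])%E.

Definition Etilde (k : nat) : \bar R :=
  ((N%:R^-1)%:E *
     'E_P[fun w => (enorm (xhat k w) ^+ 2 + 2 * enorm (zvec k w) ^+ 2)%R])%E.

End Tracking.

(* Main.v *)
Require Import Defs.
From HB Require Import structures.
From mathcomp Require Import all_boot all_order all_algebra.
From mathcomp Require Import all_classical all_reals all_analysis.
From mathcomp Require Import measurable_realfun.
From mathcomp Require Import ring lra.
From mathcomp.real_closed Require Import mxtens.
Set Implicit Arguments.
Unset Strict Implicit.
Unset Printing Implicit Defensive.

Import Order.TTheory GRing.Theory Num.Theory.
Import numFieldNormedType.Exports.

Local Open Scope classical_set_scope.
Local Open Scope ring_scope.

(** Both inequalities come from one step of the recursion, written with the noise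
    [n] and the deviation [u] of the exact gradients from their values at the
    minimizer, by an inequality that holds for every outcome followed by an
    expectation.

    Doubly stochastic mixing preserves averages, so the trackers and the sampled
    gradients have the same average ([sum_tracker]) and the mean iterate performs
    a stochastic gradient step with the averaged sampled gradient.  For the exact
    gradients, convexity and the descent inequality give decrease by the
    optimality gap, up to the consensus error ([mean_gradient_step]).  The noise
    is centred given the past, and different agents are uncorrelated by
    conditional independence, so its contribution is [alpha^2 sigma^2 / N].

    For the consensus error [xhat] and the rescaled tracking error [z], the
    recursion is driven by the matrices [W_k - Pi], which contract only over
    windows of [tau] steps.  The matrices [R_k] repair this: they satisfy the
    Lyapunov equation [R_k = delta I + Wt_k^T R_{k+1} Wt_k] ([lyap_rec]) and
    [0 <= R_k <= I] ([lyap_le]), so measured in these norms every single step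
    gains [delta] times the squared Euclidean norm.  Three quarters of the gain
    pay, through Young's inequality, for the coupling between [xhat], [z] and [u]
    ([quadratic_step]), and cocoercivity bounds [|u|^2 / N] by
    [2 L^2 |xhat|^2 / N + 4 L (f (xbar) - f (xs))] ([sum_grad_dev_le]).

    The probabilistic part rests on two facts.  A variable centred over the
    events of a sigma-field is orthogonal to every variable measurable for that
    sigma-field, as long as the product is integrable ([orthogonal_mean]); this removes the terms linear in the noise.
    Functions of different samples, conditionally independent given the past, are
    uncorrelated when one of them is conditionally centred
    ([cond_indep_uncorrelated]); it applies because the sampled gradient is
    jointly measurable in the iterate and the sample ([grad_measurable]).
    Square integrability of all iterates, which makes the expectations finite,
    propagates along the recursion from the deterministic start
    ([iterates_sqint]). *)

(** * Bilinear forms and the Euclidean inner product *)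

Section Bilinear.
Context (R : realType) (n : nat).
Implicit Types (M : 'M[R]_n) (u v w : 'cV[R]_n) (a : R).

Definition bform M u v : R := (u^T *m M *m v) 0 0.
Definition dot u v : R := bform 1%:M u v.

Lemma bformDl M u v w : bform M (u + v) w = bform M u w + bform M v w.
Proof. by rewrite /bform linearD /= !mulmxDl mxE. Qed.

Lemma bformDr M u v w : bform M u (v + w) = bform M u v + bform M u w.
Proof. by rewrite /bform mulmxDr mxE. Qed.

Lemma bformZl M a u v : bform M (a *: u) v = a * bform M u v.
Proof. by rewrite /bform linearZ /= -!scalemxAl mxE. Qed.

Lemma bformZr M a u v : bform M u (a *: v) = a * bform M u v.
Proof. by rewrite /bform -!scalemxAr mxE. Qed.

Lemma bformNl M u v : bform M (- u) v = - bform M u v.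
Proof. by rewrite -scaleN1r bformZl mulN1r. Qed.

Lemma bformNr M u v : bform M u (- v) = - bform M u v.
Proof. by rewrite -scaleN1r bformZr mulN1r. Qed.

Definition bformE := (bformDl, bformDr, bformNl, bformNr, bformZl, bformZr).

Lemma bform_sum M u v :
  bform M u v = \sum_j \sum_i M i j * (u i 0 * v j 0).
Proof.
rewrite /bform mxE; apply: eq_bigr => j _; rewrite mxE mulr_suml.
by apply: eq_bigr => i _; rewrite mxE; ring.
Qed.

Lemma bform_trmx M u v : bform M u v = bform M^T v u.
Proof.
rewrite !bform_sum exchange_big /=; apply: eq_bigr => i _.
by apply: eq_bigr => j _; rewrite mxE; ring.
Qed.

Lemma dot_sum u v : dot u v = \sum_i u i 0 * v i 0.
Proof. by rewrite /dot /bform mulmx1 mxE; apply: eq_bigr => i _; rewrite mxE. Qed.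

Lemma dotC u v : dot u v = dot v u.
Proof. by rewrite /dot bform_trmx trmx1. Qed.

Lemma dotDl u v w : dot (u + v) w = dot u w + dot v w.
Proof. exact: bformDl. Qed.

Lemma dotDr u v w : dot u (v + w) = dot u v + dot u w.
Proof. exact: bformDr. Qed.

Lemma dotZl a u v : dot (a *: u) v = a * dot u v.
Proof. exact: bformZl. Qed.

Lemma dotZr a u v : dot u (a *: v) = a * dot u v.
Proof. exact: bformZr. Qed.

Lemma dotNl u v : dot (- u) v = - dot u v.
Proof. exact: bformNl. Qed.

Lemma dotNr u v : dot u (- v) = - dot u v.
Proof. exact: bformNr. Qed.

Definition dotE := (dotDl, dotDr, dotNl, dotNr, dotZl, dotZr).

Lemma qformE M u : qform M u = bform M u u. Proof. by []. Qed.

Lemma enorm_sqr u : enorm u ^+ 2 = dot u u.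
Proof.
rewrite /enorm sqr_sqrtr ?dot_sum; last by apply: sumr_ge0 => i _; exact: sqr_ge0.
by apply: eq_bigr => i _; rewrite expr2.
Qed.

Lemma enorm_ge0 u : 0 <= enorm u. Proof. exact: sqrtr_ge0. Qed.

Lemma dot_ge0 u : 0 <= dot u u.
Proof. by rewrite -enorm_sqr sqr_ge0. Qed.

Lemma enorm_le_sqr a u v : 0 <= a ->
  (enorm u <= a * enorm v) = (dot u u <= a ^+ 2 * dot v v).
Proof.
move=> a0; rewrite -!enorm_sqr -exprMn ler_pXn2r // nnegrE ?enorm_ge0 //.
by rewrite mulr_ge0 ?enorm_ge0.
Qed.

Lemma sqr_coord_le_dot u i : u i 0 ^+ 2 <= dot u u.
Proof.
rewrite dot_sum (bigD1 i) //= expr2 lerDl; apply: sumr_ge0 => j _.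
by rewrite -expr2 sqr_ge0.
Qed.

End Bilinear.

Lemma bform_mulmx (R : realType) (m n : nat) (M : 'M[R]_m) (A B : 'M[R]_(m, n)) u v :
  bform M (A *m u) (B *m v) = bform (A^T *m M *m B) u v.
Proof. by rewrite /bform trmx_mul !mulmxA. Qed.

(** * Convex smooth functions *)
Section ConvexSmooth.
Context (R : realType) (n : nat) (f : 'cV[R]_n -> R).
Hypothesis fdiff : forall x, differentiable (f : 'cV[R]_n -> R^o) x.

Lemma derive_dot_grad x v : 'D_v (f : _ -> R^o) x = dot (grad f x) v.
Proof.
rewrite deriveE //.
have -> : v = \sum_j v j 0 *: delta_mx j 0.
  apply/matrixP => i j; rewrite ord1 summxE (bigD1 i) //= mxE mxE !eqxx mulr1.
  rewrite big1 ?addr0 // => k ki; rewrite !mxE eq_sym (negbTE ki) mulr0 //.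
rewrite linear_sum dot_sum; apply: eq_bigr => j _.
rewrite linearZ /= -deriveE // mxE mulrC; congr (_ * _).
rewrite summxE (bigD1 j) //= mxE mxE !eqxx mulr1.
by rewrite big1 ?addr0 // => k kj; rewrite !mxE eq_sym (negbTE kj) mulr0.
Qed.

Lemma is_derive_line x v (t : R) :
  is_derive t 1 (fun s : R => f (x + s *: v) : R^o) (dot (grad f (x + t *: v)) v).
Proof.
have D : derivable (f : _ -> R^o) (x + t *: v) v by exact: diff_derivable.
have E : (fun h : R => h^-1 *: ((((fun s : R => f (x + s *: v) : R^o) \o shift t)
     (h *: (1 : R^o)) : R^o) - (f (x + t *: v) : R^o))) =
   (fun h : R => h^-1 *: (((f : _ -> R^o) \o shift (x + t *: v)) (h *: v)
       - (f (x + t *: v) : R^o))).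
  apply/funext => h /=; congr (_ *: (f _ - _)).
  by rewrite [h *: 1]mulr1 scalerDl addrCA.
split; first by rewrite /derivable E.
by rewrite /derive E -derive_dot_grad.
Qed.

Variable L : R.
Hypothesis L_gt0 : 0 < L.
Hypothesis fsmooth : forall x y,
  enorm (grad f x - grad f y) <= L * enorm (x - y).

Lemma grad_lipschitz x y :
  dot (grad f x - grad f y) (grad f x - grad f y) <= L ^+ 2 * dot (x - y) (x - y).
Proof. by rewrite -enorm_le_sqr ?fsmooth // ltW. Qed.

(** The mean value theorem along the segment, applied to [f] minus its quadratic
    upper model, leaves the increment of the gradient at an intermediate point,
    which the Lipschitz bound controls. *)
Lemma descent x y :
  f y <= f x + dot (grad f x) (y - x) + L / 2 * dot (y - x) (y - x).
Proof.
move vE: (y - x) => v.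
pose phi (t : R) : R^o := f (x + t *: v) - t * dot (grad f x) v
  - L / 2 * t ^+ 2 * dot v v.
have dphi (t : R) : is_derive t 1 phi (dot (grad f (x + t *: v)) v
    - dot (grad f x) v - L * t * dot v v).
  have H := is_derive_line x v t.
  rewrite /phi; apply: is_derive_eq; rewrite /GRing.scale /=; by field.
have [c /itvP c01] : exists2 c : R, c \in `]0, 1[%R & phi 1 - phi 0 =
    (dot (grad f (x + c *: v)) v - dot (grad f x) v - L * c * dot v v) * (1 - 0).
  have cphi : {within `[0, 1], continuous phi}.
    apply: (@derivable_within_continuous R R^o phi `[0, 1]) => t _.
    exact: (@ex_derive _ _ _ _ _ _ _ (dphi t)).
  exact: (@MVT R phi _ _ _ ltr01 (fun t _ => dphi t) cphi).
rewrite subr0 mulr1 {1 2}/phi scale1r scale0r addr0 -{1}vE [x + (y - x)]addrC subrK.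
have c0 : 0 < c by rewrite c01.
have := grad_lipschitz (x + c *: v) x; rewrite addrAC subrr add0r.
rewrite -dotNl -dotDl; move: (grad f (x + c *: v) - grad f x) => G.
rewrite dotZl dotZr => HG.
(* Expanding [|G - L c v|^2 >= 0] plays the role of Cauchy-Schwarz. *)
have := dot_ge0 (G - (L * c) *: v); rewrite !dotE [dot v G]dotC => H2.
have Lc : 0 < L * c by rewrite mulr_gt0.
have H3 : L * c * (dot G v - L * c * dot v v) <= 0 by nra.
move: H3; rewrite pmulr_rle0 // => H3 E.
move: H3; rewrite subr_le0 => H3.
by move: E; rewrite expr0n expr1n /= => E; lra.
Qed.

Hypothesis fconvex : convex_function (setT : set 'cV[R]_n) (f : _ -> R^o).

(** Convexity bounds the difference quotients towards [y] by [f y - f x]; the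
    gradient term is their limit from the right. *)
Lemma convex_gradient_le x y : f x + dot (grad f x) (y - x) <= f y.
Proof.
move vE: (y - x) => v.
have D := is_derive_line x v 0; rewrite scale0r addr0 in D.
have [Dd De] := D.
rewrite -lerBrDl -De /derive.
have C := cvg_dnbhs_at_right Dd.
apply: (cvgr_to_le C).
near=> h => /=.
have h0 : 0 < h by near: h; exact: nbhs_right_gt.
have h1 : h <= 1 by near: h; apply: nbhs_right_le; exact: ltr01.
rewrite [h *: 1]mulr1 addr0 scale0r addr0 /GRing.scale /= ler_pdivrMl //.
have H : f (h *: y + (1 - h) *: x) <= h * f y + (1 - h) * f x.
  exact: (fconvex (Itv01 (ltW h0) h1) (mem_set (I : setT y)) (mem_set (I : setT x))).
move: H.
have -> : h *: y + (1 - h) *: x = x + h *: v.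
  by rewrite -vE scalerBl scalerBr scale1r addrCA.
by move=> H; lra.
Unshelve. all: by end_near. Qed.

(** A gradient step of length [1/L] from [y], for [f] tilted to be minimal at [x],
    decreases it by half the squared gradient norm over [L], but not below the
    minimum. *)
Lemma cocoercive x y :
  dot (grad f y - grad f x) (grad f y - grad f x) <=
  2 * L * (f y - f x - dot (grad f x) (y - x)).
Proof.
move GE: (grad f y - grad f x) => G; pose z := y - L^-1 *: G.
have := convex_gradient_le x z; have := descent y z.
have -> : z - x = (y - x) - L^-1 *: G by rewrite /z addrAC.
have -> : z - y = - (L^-1 *: G) by rewrite /z addrAC subrr add0r.
rewrite [dot _ (- _)]dotNr dotDr !dotNr !dotNl !dotZr !dotZl => H1 H2.
have HG : dot (grad f y) G = dot G G + dot (grad f x) G.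
  by rewrite -dotDl -GE subrK.
rewrite HG in H1.
have E : L / 2 * - - (L^-1 * (L^-1 * dot G G)) = L^-1 / 2 * dot G G.
  rewrite opprK; field; exact: lt0r_neq0.
rewrite E in H1; have Li : 0 < L^-1 by rewrite invr_gt0.
have H3 : L^-1 * dot G G <= 2 * (f y - f x - dot (grad f x) (y - x)) by lra.
by rewrite -mulrA mulrCA -ler_pdivrMl //.
Qed.
End ConvexSmooth.

(** * Kronecker lifts and stacked vectors *)

Section Kronecker.
Context (R : realType) (N d : nat).
Implicit Types (A B : 'M[R]_N) (v : 'cV[R]_(N * d)).

Definition slice v (c : 'I_d) : 'cV[R]_N := \col_i v (mxtens_index (i, c)) 0.

Lemma sum_mxtens (F : 'I_(N * d) -> R) :
  \sum_p F p = \sum_(c < d) \sum_(i < N) F (mxtens_index (i, c)).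
Proof.
rewrite exchange_big pair_big /= (reindex (@mxtens_index N d)) /=; last first.
  by exists (@mxtens_unindex N d) => i _; rewrite (mxtens_indexK, mxtens_unindexK).
by apply: eq_bigr => -[i c].
Qed.

Lemma dot_slice u v : dot u v = \sum_c dot (slice u c) (slice v c).
Proof.
rewrite dot_sum sum_mxtens; apply: eq_bigr => c _; rewrite dot_sum.
by apply: eq_bigr => i _; rewrite !mxE.
Qed.

Lemma dot_stack (u v : 'I_N -> 'cV[R]_d) :
  dot (stack u) (stack v) = \sum_i dot (u i) (v i).
Proof.
rewrite dot_sum sum_mxtens exchange_big; apply: eq_bigr => i _.
by rewrite dot_sum; apply: eq_bigr => c _; rewrite !mxE !mxtens_indexK.
Qed.

Lemma slice_lift A v c : slice (lift_mx d A *m v) c = A *m slice v c.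
Proof.
apply/matrixP => i j; rewrite !mxE sum_mxtens (bigD1 c) //= [X in _ + X]big1.
  rewrite addr0; apply: eq_bigr => k _.
  by rewrite !mxE !mxtens_indexK /= eqxx mulr1.
move=> c' cc'; apply: big1 => k _; rewrite !mxE !mxtens_indexK /=.
by rewrite eq_sym (negbTE cc') mulr0 mul0r.
Qed.

Lemma lift_stack A (v : 'I_N -> 'cV[R]_d) :
  lift_mx d A *m stack v = stack (fun i => \sum_j A i j *: v j).
Proof.
apply/matrixP => p o; rewrite ord1 {o}; case: (mxtens_indexP p) => i c.
have := slice_lift A (stack v) c => /matrixP/(_ i 0); rewrite mxE => ->.
rewrite !mxE !mxtens_indexK /= summxE; apply: eq_bigr => j _.
by rewrite !mxE !mxtens_indexK.
Qed.

Lemma lift_mxM A B : lift_mx d (A *m B) = lift_mx d A *m lift_mx d B.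
Proof. by rewrite /lift_mx tensmx_mul mulmx1. Qed.

Lemma lift_mxB A B : lift_mx d (A - B) = lift_mx d A - lift_mx d B.
Proof. by apply/matrixP => i j; rewrite !mxE mulrBl. Qed.

Lemma lift_mx1 : lift_mx d (1%:M : 'M[R]_N) = 1%:M.
Proof.
apply/matrixP => p q; case: (mxtens_indexP p) => i c.
case: (mxtens_indexP q) => j c'; rewrite !mxE !mxtens_indexK /=.
rewrite (can_eq (@mxtens_indexK _ _)) xpair_eqE.
by case: eqP; case: eqP; rewrite ?mulr1 ?mulr0.
Qed.

(** Kronecker factors act slice by slice, so a squared-norm bound for [A]
    is inherited by its lift. *)
Lemma lift_mx_bound A (c : R) :
  (forall u : 'cV[R]_N, dot (A *m u) (A *m u) <= c * dot u u) ->
  forall v, dot (lift_mx d A *m v) (lift_mx d A *m v) <= c * dot v v.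
Proof.
move=> HA v; rewrite !dot_slice mulr_sumr; apply: ler_sum => k _.
by rewrite slice_lift.
Qed.
End Kronecker.

(** * Products of mixing matrices *)

Section Chain.
Context (R : realType) (n : nat).
Implicit Type A : nat -> 'M[R]_n.

Lemma mxchain_nil A s : mxchain A s s = 1%:M.
Proof. by rewrite /mxchain /index_iota subnn big_nil. Qed.

Lemma mxchainSr A s t : (s <= t)%N -> mxchain A t.+1 s = A t *m mxchain A t s.
Proof.
move=> st; rewrite /mxchain /index_iota subSn // -addn1 iotaD rev_cat /=.
by rewrite big_cons subnKC.
Qed.

Lemma mxchain1 A s : mxchain A s.+1 s = A s.
Proof. by rewrite mxchainSr // mxchain_nil mulmx1. Qed.

Lemma mxchain_cat A r s t : (r <= s <= t)%N ->
  mxchain A t r = mxchain A t s *m mxchain A s r.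
Proof.
move=> /andP[rs /subnKC <-]; elim: (t - s)%N => [|k IH].
  by rewrite addn0 mxchain_nil mul1mx.
by rewrite addnS !mxchainSr ?leq_addr ?(leq_trans rs) ?leq_addr // IH mulmxA.
Qed.
End Chain.

Lemma mxchain_lift (R : realType) (N d : nat) (A : nat -> 'M[R]_N) s t :
  (s <= t)%N -> mxchain (fun l => lift_mx d (A l)) t s = lift_mx d (mxchain A t s).
Proof.
move=> /subnKC <-; elim: (t - s)%N => [|r IH].
  by rewrite addn0 !mxchain_nil lift_mx1.
by rewrite addnS !mxchainSr ?leq_addr // IH lift_mxM.
Qed.

Section DoublyStochastic.
Context (R : realType) (N : nat).
Implicit Types (W : 'M[R]_N) (v : 'cV[R]_N).

Lemma row_sum1 W : doubly_stochastic W -> forall i, \sum_j W i j = 1.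
Proof.
move=> [_ /matrixP H _] i; have := H i 0; rewrite !mxE => <-.
by apply: eq_bigr => j _; rewrite mxE mulr1.
Qed.

Lemma col_sum1 W : doubly_stochastic W -> forall j, \sum_i W i j = 1.
Proof.
move=> [_ _ /matrixP H] j; have := H 0 j; rewrite !mxE => <-.
by apply: eq_bigr => i _; rewrite mxE mul1r.
Qed.

(** Jensen for each row, then the column sums. *)
Lemma doubly_stochastic_le W v : doubly_stochastic W ->
  dot (W *m v) (W *m v) <= dot v v.
Proof.
move=> HW; have [W0 _ _] := HW; rewrite !dot_sum.
have J i : (W *m v) i 0 * (W *m v) i 0 <= \sum_j W i j * v j 0 ^+ 2.
  set m := (W *m v) i 0.
  have E : \sum_j W i j * (v j 0 - m) ^+ 2 = \sum_j W i j * v j 0 ^+ 2 - m * m.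
    transitivity (\sum_j W i j * v j 0 ^+ 2 - 2 * m * (\sum_j W i j * v j 0)
                  + m ^+ 2 * \sum_j W i j).
      rewrite !mulr_sumr -sumrB -big_split /=; apply: eq_bigr => j _; ring.
    rewrite (row_sum1 HW) mulr1.
    have -> : \sum_j W i j * v j 0 = m by rewrite /m mxE.
    ring.
  rewrite -subr_ge0 -E; apply: sumr_ge0 => j _.
  by rewrite mulr_ge0 // sqr_ge0.
apply: le_trans (ler_sum _ (fun i _ => J i)) _.
rewrite exchange_big /=; apply: ler_sum => j _.
by rewrite -mulr_suml (col_sum1 HW) mul1r expr2.
Qed.

Hypothesis N_gt0 : (0 < N)%N.

Lemma avgmx_mull W : doubly_stochastic W -> avgmx R N *m W = avgmx R N.
Proof.
move=> HW; apply/matrixP => i j; rewrite !mxE.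
transitivity (N%:R^-1 * \sum_k W k j); last by rewrite (col_sum1 HW) mulr1.
by rewrite mulr_sumr; apply: eq_bigr => k _; rewrite mxE.
Qed.

Lemma avgmx_mulr W : doubly_stochastic W -> W *m avgmx R N = avgmx R N.
Proof.
move=> HW; apply/matrixP => i j; rewrite !mxE.
transitivity ((\sum_k W i k) * N%:R^-1); last by rewrite (row_sum1 HW) mul1r.
by rewrite mulr_suml; apply: eq_bigr => k _; rewrite mxE.
Qed.

Lemma avgmx_doubly_stochastic : doubly_stochastic (avgmx R N).
Proof.
have E : \sum_(j < N) (N%:R^-1 : R) = 1.
  by rewrite sumr_const card_ord -[LHS]mulr_natr mulVf // pnatr_eq0 -lt0n.
split.
- by move=> i j; rewrite mxE invr_ge0 ler0n.
- by apply/matrixP => i j; rewrite !mxE -[RHS]E; apply: eq_bigr => k _; rewrite !mxE mulr1.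
- by apply/matrixP => i j; rewrite !mxE -[RHS]E; apply: eq_bigr => k _; rewrite !mxE mul1r.
Qed.

Lemma avgmx_idem : avgmx R N *m avgmx R N = avgmx R N.
Proof. exact/avgmx_mull/avgmx_doubly_stochastic. Qed.

Lemma avgmx_sym : (avgmx R N)^T = avgmx R N.
Proof. by apply/matrixP => i j; rewrite !mxE. Qed.

(** [W - Pi = W (I - Pi)], and [I - Pi] is an orthogonal projection. *)
Lemma wtilde_le (W : nat -> 'M[R]_N) k v : doubly_stochastic (W k) ->
  dot (wtilde W k *m v) (wtilde W k *m v) <= dot v v.
Proof.
move=> HW; have -> : wtilde W k = W k *m (1%:M - avgmx R N).
  by rewrite mulmxBr mulmx1 avgmx_mulr.
rewrite -mulmxA; apply: le_trans (doubly_stochastic_le _ HW) _.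
rewrite mulmxBl mul1mx !dotE.
have E : dot (avgmx R N *m v) (avgmx R N *m v) = dot (avgmx R N *m v) v.
  by rewrite /dot -{4}[v]mul1mx !bform_mulmx avgmx_sym !mulmx1 avgmx_idem.
rewrite E [dot v (_ *m v)]dotC -E.
have := dot_ge0 (avgmx R N *m v); lra.
Qed.

(** The supremum defining the operator norm is only meaningful for a bounded
    set of values; boundedness comes from the a priori bound by [1]. *)
Lemma opnorm2_le (A : 'M[R]_N) (c : R) v : 0 <= c ->
  (forall u, dot (A *m u) (A *m u) <= dot u u) -> opnorm2 A <= c ->
  dot (A *m v) (A *m v) <= c ^+ 2 * dot v v.
Proof.
move=> c0 HA Hc; rewrite -enorm_le_sqr //.
have [v0|v0] := eqVneq (enorm v) 0.
  rewrite v0 mulr0 -(mul1r 0) -{}v0 enorm_le_sqr // expr1n mul1r; exact: HA.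
have vp : 0 < enorm v by rewrite lt_neqAle eq_sym v0 enorm_ge0.
have bnd : has_ubound [set enorm (A *m w) | w in [set w : 'cV[R]_N | enorm w <= 1]].
  exists 1 => _ [w /= w1 <-]; apply: le_trans w1.
  by rewrite -[enorm w]mul1r enorm_le_sqr // expr1n mul1r; exact: HA.
have enormZ a (w : 'cV[R]_N) : 0 <= a -> enorm (a *: w) = a * enorm w.
  move=> a0; apply/eqP; rewrite -(eqrXn2 (n := 2)) ?mulr_ge0 ?enorm_ge0 //.
  by rewrite exprMn !enorm_sqr !dotE expr2 mulrA.
rewrite -ler_pdivrMr // mulrC -enormZ ?invr_ge0 ?enorm_ge0 // scalemxAr.
apply: le_trans Hc; apply: ub_le_sup => //; exists ((enorm v)^-1 *: v) => //=.
by rewrite enormZ ?invr_ge0 ?enorm_ge0 // mulVf.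
Qed.
End DoublyStochastic.

(** * The Lyapunov matrix of the network *)
Lemma cvg_mx_coord (R : realType) (m n : nat) (S : nat -> 'M[R]_(m, n)) (l : 'M[R]_(m, n)) :
  (forall i j, (fun k => S k i j) @ \oo --> l i j) -> S @ \oo --> l.
Proof.
move=> Sl; apply/cvg_ballP => e e0.
have near_ij (p : 'I_m * 'I_n) : \forall k \near \oo, ball (l p.1 p.2) e (S k p.1 p.2).
  by have /cvg_ballP/(_ _ e0) := Sl p.1 p.2.
have all_ij := filter_forall _ near_ij.
have : \forall k \near \oo, ball l e (S k).
  near=> k; split => // i j.
  have : forall p, ball (l p.1 p.2) e (S k p.1 p.2).
    by near: k; exact: all_ij.
  by move/(_ (i, j)).
exact.
Unshelve. all: by end_near. Qed.

Section Lyapunov.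
Context (R : realType) (n : nat) (A : nat -> 'M[R]_n) (tau : nat) (lambda : R).
Hypothesis tau_gt0 : (1 <= tau)%N.
Hypothesis lambda01 : 0 <= lambda < 1.
Hypothesis A_le : forall k v, dot (A k *m v) (A k *m v) <= dot v v.
Hypothesis A_contr : forall k v,
  dot (mxchain A (k + tau) k *m v) (mxchain A (k + tau) k *m v)
    <= lambda ^+ 2 * dot v v.

Definition gram k r := (mxchain A (k + r) k)^T *m mxchain A (k + r) k.
Definition energy k m v := \sum_(r < m) qform (gram k r) v.
Local Notation del := (delta tau lambda).

Lemma delta_gt0 : 0 < del.
Proof.
rewrite /delta divr_gt0 ?ltr0n // subr_gt0.
by case/andP: lambda01 => l0 l1; rewrite exprn_ilt1.
Qed.

Lemma delta_le1 : del <= 1.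
Proof.
rewrite /delta ler_pdivrMr ?ltr0n // mul1r.
have t1 : (1 : R) <= tau%:R by rewrite ler1n.
by have := sqr_ge0 lambda; lra.
Qed.

Lemma qform_gram k r v : qform (gram k r) v =
  dot (mxchain A (k + r) k *m v) (mxchain A (k + r) k *m v).
Proof. by rewrite /dot bform_mulmx mulmx1. Qed.

Lemma energyS k m v : energy k m.+1 v = dot v v + energy k.+1 m (A k *m v).
Proof.
rewrite /energy big_ord_recl qform_gram addn0 mxchain_nil mul1mx.
congr (_ + _); apply: eq_bigr => r _; rewrite !qform_gram lift0.
rewrite (@mxchain_cat _ _ _ k k.+1); last by rewrite leqnSn addnS ltnS leq_addr.
by rewrite mxchain1 mulmxA addSnnS.
Qed.

Lemma energyD k m p v :
  energy k (m + p) v = energy k m v + energy (k + m) p (mxchain A (k + m) k *m v).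
Proof.
elim: m k v => [|m IH] k v.
  by rewrite {2}/energy big_ord0 add0r addn0 mxchain_nil mul1mx.
rewrite addSn !energyS IH -addrA; congr (_ + (_ + _)).
rewrite addSnnS mulmxA; congr (energy _ _ (_ *m _)).
rewrite [RHS](@mxchain_cat _ _ _ k k.+1) ?mxchain1 //.
by rewrite leqnSn addnS ltnS leq_addr.
Qed.

Lemma energy_le_card k m v : energy k m v <= m%:R * dot v v.
Proof.
elim: m k v => [|m IH] k v; first by rewrite /energy big_ord0 mul0r.
rewrite energyS -natr1 mulrDl mul1r addrC lerD2r.
by apply: le_trans (IH _ _) _; rewrite ler_wpM2l.
Qed.

(** Each block of [tau] terms costs at most [tau |v|^2] and shrinks the energy
    left by [lambda^2], so the geometric bound [tau / (1 - lambda^2)] is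
    reproduced by adding one block. *)
Lemma energy_le k m v : del * energy k m v <= dot v v.
Proof.
have d0 := delta_gt0.
have dt : del * tau%:R = 1 - lambda ^+ 2.
  by rewrite /delta divfK // pnatr_eq0 -lt0n.
elim/ltn_ind: m k v => m IH k v; have [mt|tm] := leqP m tau.
  have : energy k m v <= tau%:R * dot v v.
    apply: le_trans (energy_le_card _ _ _) _.
    by rewrite ler_wpM2r ?dot_ge0 // ler_nat.
  rewrite -(ler_pM2l d0) mulrA dt => H; apply: le_trans H _.
  have := mulr_ge0 (sqr_ge0 lambda) (dot_ge0 v); lra.
rewrite -(subnKC (ltnW tm)) energyD mulrDr.
have mt : (m - tau < m)%N by rewrite ltn_subrL tau_gt0 (leq_trans tau_gt0) // ltnW.
have H1 := IH _ mt (k + tau)%N (mxchain A (k + tau) k *m v).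
have H2 : del * energy k tau v <= (1 - lambda ^+ 2) * dot v v.
  rewrite -dt -[leRHS]mulrA; apply: ler_wpM2l; first exact: ltW.
  exact: energy_le_card.
have := A_contr k v; lra.
Qed.

Lemma gram_sum_qform k m v : qform (series (gram k) m) v = energy k m v.
Proof.
rewrite /energy /series /= big_mkord.
elim/big_rec2: _ => [|r x y _ <-]; first by rewrite /qform mulmx0 mul0mx mxE.
by rewrite /qform mulmxDr mulmxDl mxE.
Qed.

Lemma energy_cvg k v : cvgn (fun m => energy k m v).
Proof.
apply: nondecreasing_is_cvgn.
  apply/nondecreasing_seqP => m; rewrite /energy big_ord_recr /= lerDl.
  by rewrite qform_gram dot_ge0.
exists (dot v v / del) => _ [m _ <-].
by rewrite ler_pdivlMr ?delta_gt0 // mulrC energy_le.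
Qed.

Lemma bform_delta (M : 'M[R]_n) i j : bform M (delta_mx i 0) (delta_mx j 0) = M i j.
Proof.
by rewrite /bform trmx_delta -rowE -colE !mxE.
Qed.

(** Entries of a symmetric matrix are polarizations of its quadratic form, so
    monotone convergence of the energies gives convergence of the matrices. *)
Lemma gram_series_cvg k : cvgn (series (gram k)).
Proof.
have symS m : (series (gram k) m)^T = series (gram k) m.
  rewrite /series /= linear_sum; apply: eq_bigr => r _ /=.
  by rewrite trmx_mul trmxK.
have polar m i j : series (gram k) m i j = 2^-1 *
    (energy k m (delta_mx i 0 + delta_mx j 0) - energy k m (delta_mx i 0)
     - energy k m (delta_mx j 0)).
  rewrite -!gram_sum_qform !qformE !bformE !bform_delta.
  have -> : series (gram k) m j i = series (gram k) m i j.
    by rewrite -{1}symS mxE.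
  by field.
pose l := \matrix_(i, j) limn (fun m => series (gram k) m i j).
apply/cvg_ex; exists l; apply: cvg_mx_coord => i j; rewrite mxE.
change (cvgn (fun m => series (gram k) m i j)).
under eq_fun do rewrite polar.
apply: is_cvgM; first exact: is_cvg_cst.
by apply: is_cvgB; [apply: is_cvgB|]; exact: energy_cvg.
Qed.

(** For lifted mixing matrices this is [R_k]. *)
Definition lyap k : 'M[R]_n := del *: limn (series (gram k)).

Lemma qform_lyap_cvg k v :
  (fun m => del * energy k m v) @ \oo --> qform (lyap k) v.
Proof.
rewrite /lyap; set l := limn _.
have -> : qform (del *: l) v = del * qform l v.
  by rewrite /qform -scalemxAr -scalemxAl mxE.
apply: cvgM; first exact: cvg_cst.
under eq_fun do rewrite -gram_sum_qform qformE bform_sum.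
rewrite qformE bform_sum.
apply: cvg_big => [|j _]; first exact: add_continuous.
apply: cvg_big => [|i _]; first exact: add_continuous.
apply: cvgM; last exact: cvg_cst.
exact: (cvg_comp _ _ (@gram_series_cvg k) (@coord_continuous _ _ _ i j l)).
Qed.

Lemma lyap_ge0 k v : 0 <= qform (lyap k) v.
Proof.
apply: (cvgr_to_ge (@qform_lyap_cvg k v)); near=> m.
rewrite mulr_ge0 ?(ltW delta_gt0) //; apply: sumr_ge0 => r _.
by rewrite qform_gram dot_ge0.
Unshelve. all: by end_near. Qed.

(** The factor [delta] is the inverse of the geometric bound on the energy. *)
Lemma lyap_le k v : qform (lyap k) v <= dot v v.
Proof.
apply: (cvgr_to_le (@qform_lyap_cvg k v)); near=> m; exact: energy_le.
Unshelve. all: by end_near. Qed.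

(** Splitting off the first term of the series: the Lyapunov equation. *)
Lemma lyap_rec k v :
  qform (lyap k) v = del * dot v v + qform (lyap k.+1) (A k *m v).
Proof.
have C1 := @qform_lyap_cvg k.+1 (A k *m v).
have C2 : (fun m => del * energy k m.+1 v) @ \oo -->
    del * dot v v + qform (lyap k.+1) (A k *m v).
  under eq_fun do rewrite energyS mulrDr.
  by apply: cvgD => //; exact: cvg_cst.
have C3 := @qform_lyap_cvg k v; rewrite -cvg_shiftS /= in C3.
exact: cvg_unique C3 C2.
Qed.
End Lyapunov.

(** * One step in the Lyapunov norm *)

Section QuadraticStep.
Context (R : realType) (n : nat) (M : 'M[R]_n).
Hypothesis M_ge0 : forall v, 0 <= qform M v.

Lemma young_qform (t : R) a b : 0 < t ->
  bform M a b + bform M b a <= t * qform M a + t^-1 * qform M b.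
Proof.
move=> t0; have := M_ge0 (t *: a - b); rewrite !qformE !bformE => H.
rewrite -(ler_pM2l t0) !mulrDr mulVKf ?gt_eqF //; lra.
Qed.

Context (eta del alpha : R).
Hypothesis eta_gt0 : 0 < eta.
Hypothesis eta_le : 2 * eta <= del.
Hypothesis del_le1 : del <= 1.
Hypothesis alpha_gt0 : 0 < alpha.

(** Young's inequality on each cross term.  The contraction gains
    [del |x|^2 + 2 del |z|^2]; a quarter of it is kept, and the rest pays for the
    cross terms at the price of a multiple of [|u|^2] of order [Q / del]. *)
Lemma quadratic_step (a b c e x z u : 'cV[R]_n) :
  qform M a <= dot x x -> qform M b <= dot z z -> qform M c <= dot u u ->
  qform M e <= 4 * dot u u ->
  qform M (a - eta *: b - alpha *: c) + 2 * qform M (b + (alpha / eta) *: e)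
  <= qform M a + 2 * qform M b
     + del * (dot x x + 2 * dot z z) - del / 4 * (dot x x + 2 * dot z z)
     + 5 * alpha ^+ 2 * (1 + 8 / eta ^+ 2) / del * dot u u.
Proof.
move=> Ha Hb Hc He.
have d0 : 0 < del by apply: lt_le_trans eta_le; rewrite mulr_gt0.
have i0 : 0 < alpha / eta by rewrite divr_gt0.
set g := alpha / eta in i0 *.
have qa0 := M_ge0 a; have qb0 := M_ge0 b; have qc0 := M_ge0 c.
have qe0 := M_ge0 e.
have h4 : 0 < 4^-1 :> R by rewrite invr_gt0.
have hd : 0 < del / 4 by rewrite divr_gt0.
have hd5 : 0 < 5 / 16 * del by rewrite mulr_gt0 // divr_gt0.
(* The weights share the available [3/4 del] among the cross terms; the last
   one, against [e], is chosen so that [16 / (5 del)] times [2 * 4] stays below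
   the [40 / del] allowed in front of [(alpha / eta)^2 |u|^2]. *)
have Y1 := @young_qform 1 (- a) b ltr01.
have Y2 := @young_qform (del / 4) (- a) (alpha *: c) hd.
have Y3 := @young_qform (4^-1) b (alpha *: c) h4.
have Y4 := @young_qform (5 / 16 * del) b (g *: e) hd5.
move: Y1 Y2 Y3 Y4; rewrite !qformE !bformE.
rewrite !qformE in qa0 qb0 qc0 qe0 Ha Hb Hc He.
have -> : (del / 4)^-1 = 4 / del.
  by field; rewrite gt_eqF.
have -> : (5 / 16 * del)^-1 = 16 / 5 / del.
  by field; rewrite gt_eqF.
rewrite invr1 !invrK.
move: (bform M a a) (bform M b b) (bform M c c) (bform M e e) qa0 qb0 qc0 qe0 Ha Hb Hc He.
move: (bform M a b) (bform M b a) (bform M a c) (bform M c a) (bform M b c)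
  (bform M c b) (bform M b e) (bform M e b) (dot x x) (dot z z) (dot u u).
move=> ab ba ac ca bc cb be eb X Z U aa bb cc ee a0 b0 c0 e0 aX bZ cU eU Y1 Y2 Y3 Y4.
have X0 : 0 <= X by exact: le_trans aX.
have Z0 : 0 <= Z by exact: le_trans bZ.
have U0 : 0 <= U by exact: le_trans cU.
have eta_half : eta <= 1 / 2.
  by move: eta_le del_le1 => *; lra.
have e2 := eta_le; have d1 := del_le1; have e0' := eta_gt0.
set AU := alpha ^+ 2 * U; set GU := g ^+ 2 * U.
have -> : 5 * alpha ^+ 2 * (1 + 8 / eta ^+ 2) / del * U = 5 * (AU / del) + 40 * (GU / del).
  by rewrite /AU /GU /g; field; rewrite !gt_eqF.
have AU0 : 0 <= AU by rewrite mulr_ge0 ?sqr_ge0.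
have GU0 : 0 <= GU by rewrite mulr_ge0 ?sqr_ge0.
have F1 : eta * (- ab - ba) <= del / 2 * (X + Z).
  apply: le_trans (_ : eta * (X + Z) <= _); first by rewrite ler_pM2l //; lra.
  by rewrite ler_wpM2r ?addr_ge0 //; lra.
have acc : alpha * (alpha * cc) <= AU.
  by rewrite mulrA -expr2 ler_wpM2l ?sqr_ge0.
have gee : g * (g * ee) <= 4 * GU.
  by rewrite mulrA -expr2 /GU mulrCA ler_wpM2l ?sqr_ge0.
have F2 : del / 4 * - - aa + 4 / del * (alpha * (alpha * cc)) <= del / 4 * X + 4 * (AU / del).
  have K : alpha * (alpha * cc) / del <= AU / del by rewrite ler_pM2r ?invr_gt0.
  have -> : 4 / del * (alpha * (alpha * cc)) = 4 * (alpha * (alpha * cc) / del).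
    by field; rewrite gt_eqF.
  have : del / 4 * aa <= del / 4 * X by rewrite ler_pM2l.
  by rewrite opprK; lra.
have F3 : eta * (alpha * bc + alpha * cb) <= del / 8 * Z + 2 * AU.
  apply: le_trans (_ : eta * (4^-1 * Z + 4 * AU) <= _).
    rewrite ler_pM2l //; apply: le_trans Y3 _; lra.
  have := ler_wpM2r Z0 eta_le; have := ler_wpM2r AU0 eta_half; lra.
have F4 : g * be + g * eb <= 5 / 16 * del * Z + 64 / 5 * (GU / del).
  apply: le_trans Y4 _; apply: lerD; first by rewrite ler_pM2l.
  rewrite [leRHS](_ : _ = 16 / 5 / del * (4 * GU)); last by field; rewrite gt_eqF.
  by rewrite ler_pM2l // !divr_gt0.
have F5 : eta * (eta * bb) <= del / 4 * Z.
  rewrite mulrA; apply: le_trans (_ : eta * eta * Z <= _).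
    by rewrite ler_pM2l ?mulr_gt0.
  by apply: ler_wpM2r => //; nra.
have F6 : AU <= AU / del by rewrite ler_pdivlMr // ler_piMr.
have F7 : GU <= GU / del by rewrite ler_pdivlMr // ler_piMr.
have F8 : AU <= GU / 4.
  have -> : AU = eta ^+ 2 * GU by rewrite /AU /GU /g; field; rewrite gt_eqF.
  have : eta ^+ 2 <= 1 / 4 by nra.
  by move=> /(ler_wpM2r GU0); lra.
move: F1 F2 F3 F4 F5 F6 F7 F8 Y2 acc gee.
move: (AU / del) (GU / del) => P G; move=> *; lra.
Qed.
End QuadraticStep.

(** * Expectations of real random variables *)

Section Mean.
Context (R : realType) (dO : measure_display) (Omega : measurableType dO)
  (P : probability Omega R).
Implicit Types (f g U V : Omega -> R) (G : set (set Omega)).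

Definition integ f := P.-integrable setT (EFin \o f).
Definition mean f : R := \int[P]_w f w.

Lemma integ_meas f : integ f -> measurable_fun setT f.
Proof. by move=> /integrableP[/measurable_EFinP]. Qed.

Lemma expectation_mean f : integ f -> ('E_P[f] = (mean f)%:E)%E.
Proof.
move=> If; rewrite unlock /mean /Rintegral fineK //.
exact: integrable_fin_num If.
Qed.

Lemma integD f g : integ f -> integ g -> integ (fun w => f w + g w).
Proof. exact: integrableD. Qed.

Lemma integB f g : integ f -> integ g -> integ (fun w => f w - g w).
Proof. exact: integrableB. Qed.

Lemma integZ a f : integ f -> integ (fun w => a * f w).
Proof. exact: integrableZl. Qed.

Lemma integ_sum (I : Type) (s : seq I) (F : I -> Omega -> R) :
  (forall i, integ (F i)) -> integ (fun w => \sum_(i <- s) F i w).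
Proof.
move=> HF; rewrite /integ (_ : _ \o _ = fun w => (\sum_(i <- s) (F i w)%:E)%E).
  by apply: integrable_sum => // i _; exact: HF.
by apply/funext => w /=; rewrite sumEFin.
Qed.

Lemma integ_le f g : measurable_fun setT f -> (forall w, `|f w| <= g w) ->
  integ g -> integ f.
Proof.
move=> mf fg; apply: le_integrable => //; first exact/measurable_EFinP.
by move=> w _; rewrite /= lee_fin; apply: le_trans (fg w) _; exact: ler_norm.
Qed.

Lemma integ_cst a : integ (fun=> a).
Proof. exact: finite_measure_integrable_cst. Qed.

Lemma integ_indic A f : measurable A -> integ f -> integ (fun w => \1_A w * f w).
Proof.
move=> mA If; apply: (@integ_le _ (fun w => `|f w|)).
- by apply: measurable_funM => //; exact: integ_meas.
- by move=> w; rewrite indicE; case: (w \in A); rewrite ?mul1r // mul0r normr0.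
- exact: integrable_norm.
Qed.

Lemma meanD f g : integ f -> integ g ->
  mean (fun w => f w + g w) = mean f + mean g.
Proof. exact: RintegralD. Qed.

Lemma meanB f g : integ f -> integ g ->
  mean (fun w => f w - g w) = mean f - mean g.
Proof. exact: RintegralB. Qed.

Lemma meanZ a f : integ f -> mean (fun w => a * f w) = a * mean f.
Proof. exact: RintegralZl. Qed.

Lemma mean_sum (I : Type) (s : seq I) (F : I -> Omega -> R) :
  (forall i, integ (F i)) ->
  mean (fun w => \sum_(i <- s) F i w) = \sum_(i <- s) mean (F i).
Proof.
move=> HF; elim: s => [|i s IH].
  by rewrite /mean; under eq_fun do rewrite big_nil; rewrite big_nil Rintegral_cst // mul0r.
rewrite big_cons -IH -meanD //; last exact: integ_sum.
by congr mean; apply/funext => w; rewrite big_cons.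
Qed.

Lemma mean_cst a : mean (fun=> a) = a.
Proof. by rewrite /mean Rintegral_cst // [X in fine X](@probability_setT _ _ _ P) mulr1. Qed.

Lemma le_mean f g : integ f -> integ g -> (forall w, f w <= g w) ->
  mean f <= mean g.
Proof. by move=> If Ig fg; apply: le_Rintegral => // w _. Qed.

Lemma mean_indicE A f : mean (fun w => \1_A w * f w) = fine (\int[P]_(w in A) (f w)%:E)%E.
Proof.
rewrite /mean -/(Rintegral P A f) [RHS]Rintegral_mkcond; congr (Rintegral _ _ _).
by rewrite patch_indic; apply/funext => w; rewrite mulrC.
Qed.

(** A collection of sets over which a given integrable function integrates to
    zero is a Dynkin system, so it suffices to know it on a generating pi-system. *)
Lemma mean_zero_generated (C : set (set Omega)) V :
  setI_closed C -> C setT -> C `<=` measurable -> integ V ->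
  (forall A, C A -> mean (fun w => \1_A w * V w) = 0) ->
  forall A, <<s C >> A -> mean (fun w => \1_A w * V w) = 0.
Proof.
move=> CI CT Cm IV HC A; rewrite -setI_closed_g_dynkin_g_sigma_algebra // => CA.
suff: [set B | measurable B /\ mean (fun w => \1_B w * V w) = 0] A by case.
move: A CA; apply: smallest_sub; last by move=> B CB; split; [exact: Cm|exact: HC].
split.
- by split; [exact: measurableT|exact: HC].
- move=> B [mB HB]; split; first exact: measurableC.
  have -> : (fun w => \1_(~` B) w * V w) = (fun w => \1_setT w * V w - \1_B w * V w).
    apply/funext => w; rewrite -mulrBl; congr (_ * _); rewrite !indicE in_setT in_setC.
    by case: (w \in B); rewrite ?subrr ?subr0.
  by rewrite meanB ?HB ?HC ?subr0 //; exact: integ_indic.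
- move=> F tF HF; have mF k : measurable (F k) by case: (HF k).
  split; first exact: bigcupT_measurable.
  rewrite mean_indicE integral_bigcup //; last first.
    by apply: (integrableS _ _ _ IV) => //; exact: bigcupT_measurable.
  rewrite eseries0 // => k _ _; have [_] := HF k; rewrite mean_indicE => H.
  rewrite -[LHS]fineK ?H //; apply: integrable_fin_num => //.
  by apply: (integrableS _ _ _ IV).
Qed.

Lemma measurable_wrt_sub G (HG : sub_sigma_field G) dT (T : measurableType dT)
    (X : Omega -> T) : measurable_wrt G X -> measurable_fun setT X.
Proof.
move=> H _ B mB; have := H measurableT B mB.
by case: HG => sG GM; rewrite /measurable /= sigma_algebra_id // => /GM.
Qed.

Lemma measurable_wrtP G (HG : sub_sigma_field G) dT (T : measurableType dT)
    (X : Omega -> T) B : measurable_wrt G X -> measurable B -> G (X @^-1` B).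
Proof.
move=> H mB; have := H measurableT B mB.
by case: HG => sG GM; rewrite setTI /measurable /= sigma_algebra_id.
Qed.

Import HBNNSimple.

Section Orthogonality.
Variables (G : set (set Omega)) (V : Omega -> R).
Hypothesis HG : sub_sigma_field G.
Hypothesis IV : integ V.
Hypothesis V0 : forall A, G A -> mean (fun w => \1_A w * V w) = 0.

(** True for simple functions by linearity, hence for [U] by dominated
    convergence: approximate [U] from below by simple functions measurable for
    [G], whose products with [V] are dominated by [`|U V|]. *)
Lemma orthogonal_ge0 U : measurable_wrt G U -> (forall w, 0 <= U w) ->
  integ (fun w => U w * V w) -> mean (fun w => U w * V w) = 0.
Proof.
move=> mU U0 IUV.
have mU' : measurable_fun setT (EFin \o U : g_sigma_algebraType G -> \bar R).
  exact/measurable_EFinP.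
pose s := nnsfun_approx measurableT mU'.
have scvg w : (fun n => (s n w : R)) @ \oo --> U w.
  have U0' (x : g_sigma_algebraType G) : setT x -> (0 <= (EFin \o U) x)%E.
    by move=> _; rewrite lee_fin.
  by have /fine_cvgP[_] := @cvg_nnsfun_approx _ _ _ _ measurableT _ mU' U0' w I.
have s_le n w : s n w <= U w.
  have nd : nondecreasing_seq (fun n => (s n w : R)).
    move=> m p mp.
    by have /lefP := @nd_nnsfun_approx _ (g_sigma_algebraType G) _ _ measurableT _ mU' m p mp.
  have <- : limn (fun n => (s n w : R)) = U w by apply: cvg_lim.
  by apply: nondecreasing_cvgn_le => //; apply/cvg_ex; exists (U w).
have ms n : measurable_wrt G (s n : Omega -> R) by exact: measurable_funPT.
have sV0 n : mean (fun w => s n w * V w) = 0.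
  have [m [c cE]] : exists m (c : nat -> R), forall w,
      s n w = \sum_(i < m) c i * \1_(s n @^-1` [set c i]) w.
    by eexists; eexists (fun i => _`_i) => w; exact: fimfunEord.
  have GA r : G (s n @^-1` [set r]) by exact: (measurable_wrtP HG (ms n)).
  have -> : (fun w => s n w * V w) =
      (fun w => \sum_(i < m) c i * (\1_(s n @^-1` [set c i]) w * V w)).
    apply/funext => w; rewrite cE mulr_suml; apply: eq_bigr => i _.
    by rewrite mulrA.
  have IA r : integ (fun w => \1_(s n @^-1` [set r]) w * V w).
    by apply: integ_indic => //; exact: (proj2 HG).
  rewrite mean_sum => [|i]; last exact: integZ.
  by apply: big1 => i _; rewrite meanZ // V0 ?mulr0.
have DC := @dominated_cvg _ _ _ P setT measurableT
  (fun n w => (s n w * V w)%:E) (fun w => (U w * V w)%:E)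
  (fun w => `|U w * V w|%:E).
have : (\int[P]_w (s n w * V w)%:E)%E @[n --> \oo] --> (\int[P]_w (U w * V w)%:E)%E.
  apply: DC.
  - move=> n; apply/measurable_EFinP; apply: measurable_funM; last exact: integ_meas.
    exact: (measurable_wrt_sub HG (ms n)).
  - move=> w _; apply: cvg_EFin; first by apply: nearW.
    by apply: cvgM => //; exact: cvg_cst.
  - by move=> w _.
  - exact: (integrable_norm IUV).
  - move=> n w _; rewrite /= lee_fin !normrM ler_wpM2r // ger0_norm //.
    by rewrite ger0_norm.
have -> : (fun n => (\int[P]_w (s n w * V w)%:E)%E) = cst 0%E.
  apply/funext => n; rewrite -[LHS]fineK; first by congr EFin; exact: sV0.
  apply: integrable_fin_num => //.
  apply: (@integ_le _ (fun w => `|U w * V w|)); last exact: (integrable_norm IUV).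
    apply: measurable_funM; last exact: integ_meas.
    exact: (measurable_wrt_sub HG (ms n)).
  by move=> w; rewrite !normrM ler_wpM2r // !ger0_norm.
move=> C; rewrite /mean /Rintegral.
by rewrite -(cvg_unique _ (@cvg_cst _ _ _ _ _) C).
Qed.

Lemma orthogonal_mean U : measurable_wrt G U ->
  integ (fun w => U w * V w) -> mean (fun w => U w * V w) = 0.
Proof.
move=> mU IUV.
have mUO := measurable_wrt_sub HG mU.
have Ipos (W : Omega -> R) : measurable_wrt G W -> (forall w, `|W w| <= `|U w|) ->
    integ (fun w => W w * V w).
  move=> mW WU; apply: (@integ_le _ (fun w => `|U w * V w|)).
  - by apply: measurable_funM; [exact: measurable_wrt_sub mW|exact: integ_meas].
  - by move=> w; rewrite !normrM ler_wpM2r.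
  - exact: (integrable_norm IUV).
have mp : measurable_wrt G (fun w => Num.max (U w) 0).
  exact: (@measurable_maxr _ _ _ _ _ (cst 0)).
have mm : measurable_wrt G (fun w => Num.max (- U w) 0).
  by apply: (@measurable_maxr _ _ _ _ _ (cst 0)) => //; exact: measurable_funN.
have Ip : integ (fun w => Num.max (U w) 0 * V w).
  apply: Ipos => // w; case: (leP 0 (U w)) => H; rewrite ?normr0 //.
have Im : integ (fun w => Num.max (- U w) 0 * V w).
  apply: Ipos => // w; case: (leP 0 (- U w)) => H; rewrite ?normr0 ?normrN //.
have -> : (fun w => U w * V w) =
    (fun w => Num.max (U w) 0 * V w - Num.max (- U w) 0 * V w).
  apply/funext => w; rewrite -mulrBl; congr (_ * _).
  by case: (leP 0 (U w)); case: (leP 0 (- U w)); lra.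
by rewrite meanB // !orthogonal_ge0 ?subr0 // => w; rewrite le_max lexx orbT.
Qed.
End Orthogonality.
End Mean.

(** * Measurability of sampled gradients *)

Section Caratheodory.
Context (R : realType) (d : nat) (dT : measure_display) (T : measurableType dT)
  (dS : measure_display) (S : measurableType dS).
Variables (X : T -> 'cV[R]_d) (Z : T -> S).
Hypothesis mX : forall j, measurable_fun setT (fun w => X w j 0).
Hypothesis mZ : measurable_fun setT Z.

Let grid (n : nat) (c : 'cV[int]_d) : 'cV[R]_d := \col_j ((c j 0)%:~R / n.+1%:R).
Let cell (n : nat) (x : 'cV[R]_d) : 'cV[int]_d := \col_j Num.floor (x j 0 * n.+1%:R).

Let grid_cvg x : (fun n => grid n (cell n x)) @ \oo --> x.
Proof.
apply: cvg_mx_coord => i j; rewrite ord1 {j}.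
have b n : `|x i 0 - grid n (cell n x) i 0| <= harmonic n.
  rewrite !mxE /harmonic /=.
  have n0 : 0 < n.+1%:R :> R by rewrite ltr0n.
  have /andP[f1 f2] := floor_itv (x i 0 * n.+1%:R).
  set c := Num.floor _ in f1 f2 *.
  have -> : x i 0 - c%:~R / n.+1%:R = (x i 0 * n.+1%:R - c%:~R) / n.+1%:R.
    by rewrite mulrBl mulfK ?gt_eqF.
  rewrite normrM ger0_norm ?subr_ge0 // ger0_norm ?invr_ge0 ?ler0n //.
  by rewrite ler_piMl ?invr_ge0 ?ler0n // lerBlDr addrC -(intrD _ c 1) ltW.
apply/cvgrPdist_le => e e0.
have /cvgrPdist_le/(_ e e0) := @cvg_harmonic R.
apply: filterS => n; rewrite sub0r normrN => H; apply: le_trans (b n) _.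
by apply: le_trans H; exact: ler_norm.
Qed.

(** Rounding the vector to a grid leaves countably many values, for each of which
    measurability in the sample suffices; continuity in the vector recovers the
    function as the mesh shrinks. *)
Lemma caratheodory_comp_measurable (H : 'cV[R]_d -> S -> R) :
  (forall s, continuous (fun x => H x s)) ->
  (forall x, measurable_fun setT (H x)) ->
  measurable_fun setT (fun w => H (X w) (Z w)).
Proof.
move=> cH mH.
apply: (@measurable_fun_cvg _ _ _ setT
  (fun n w => H (grid n (cell n (X w))) (Z w))) => [n|w _]; last first.
  exact: (cvg_comp _ _ (@grid_cvg (X w)) (cH (Z w) (X w))).
move=> _ B mB; rewrite setTI.
have -> : (fun w => H (grid n (cell n (X w))) (Z w)) @^-1` B =
    \bigcup_(c in [set: 'cV[int]_d])
      ([set w | cell n (X w) = c] `&` (fun w => H (grid n c) (Z w)) @^-1` B).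
  apply/seteqP; split=> [w /= HB|w [c _ [/= <-]] //].
  by exists (cell n (X w)).
apply: countable_bigcupT_measurable => [|c]; first exact: countableP.
apply: measurableI; last first.
  rewrite -[X in measurable X]setTI.
  have := measurableT_comp (mH (grid n c)) mZ; exact.
have -> : [set w | cell n (X w) = c] = \bigcap_(j in [set: 'I_d])
    ((fun w => X w j 0) @^-1`
      `[((c j 0)%:~R / n.+1%:R : R), ((c j 0 + 1)%:~R / n.+1%:R)[%classic).
  have n0 : 0 < n.+1%:R :> R by rewrite ltr0n.
  apply/seteqP; split=> [w /= <- j _|w /= Hw].
    rewrite /= in_itv /= mxE ler_pdivrMr // ltr_pdivlMr //; exact: floor_itv.
  apply/matrixP => j k; rewrite ord1 mxE.
  have := Hw j I; rewrite /= in_itv /= ler_pdivrMr // ltr_pdivlMr //.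
  by move/floor_def.
apply: fin_bigcap_measurable => // j _; rewrite -[X in measurable X]setTI.
by apply: mX => //; exact: measurable_itv.
Qed.
End Caratheodory.

(** Partial derivatives as limits along a sequence, as measurability requires. *)
Lemma delta_quotient_cvg (R : realType) (d : nat) (f : 'cV[R]_d -> R) x (j : 'I_d) :
  differentiable (f : 'cV[R]_d -> R^o) x ->
  (fun n => n.+1%:R * (f (harmonic n *: delta_mx j 0 + x) - f x)) @ \oo
    --> grad f x j 0.
Proof.
move=> Df; rewrite /grad mxE.
have D : derivable (f : _ -> R^o) x (delta_mx j 0) by exact: diff_derivable.
have H := (@cvgr_dnbhsP R (fun h => h^-1 * (f (h *: delta_mx j 0 + x) - f x)) 0
  ('D_(delta_mx j 0) (f : _ -> R^o) x)).1 D (@harmonic R).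
apply: cvg_trans (H _); last first.
  split => //; last exact: cvg_harmonic.
  by move=> n; rewrite /harmonic /= invr_eq0 pnatr_eq0.
apply: near_eq_cvg; near=> n.
by rewrite /GRing.scale /= /harmonic /= invrK.
Unshelve. all: by end_near. Qed.

Section GradientMeasurable.
Context (R : realType) (d : nat) (dT : measure_display) (T : measurableType dT)
  (dS : measure_display) (S : measurableType dS).
Variables (X : T -> 'cV[R]_d) (Z : T -> S).
Hypothesis mX : forall j, measurable_fun setT (fun w => X w j 0).
Hypothesis mZ : measurable_fun setT Z.

(** Sampled partial derivatives are pointwise limits of difference quotients, to
    which [caratheodory_comp_measurable] applies. *)
Lemma grad_measurable (F : 'cV[R]_d -> S -> R) j :
  (forall s x, differentiable (fun y => F y s : R^o) x) ->
  (forall x, measurable_fun setT (F x)) ->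
  measurable_fun setT (fun w => grad (fun y => F y (Z w)) (X w) j 0).
Proof.
move=> DF mF.
pose Q n (x : 'cV[R]_d) s := n.+1%:R * (F (harmonic n *: delta_mx j 0 + x) s - F x s).
apply: (@measurable_fun_cvg _ _ _ setT (fun n w => Q n (X w) (Z w))) => [n|w _].
  apply: (caratheodory_comp_measurable mX mZ) => [s x|x]; last first.
    by apply: measurable_funM => //; exact: measurable_funB.
  have cF y : {for y, continuous (fun y => F y s)}.
    exact: (differentiable_continuous (DF s y)).
  apply: (@cvgM _ _ (nbhs x)); first exact: cvg_cst.
  apply: (@cvgB _ _ _ (nbhs x)); last exact: cF.
  apply: (@cvg_comp _ _ _ (fun x => harmonic n *: delta_mx j 0 + x)
    (fun y => F y s)); last exact: cF.
  by apply: cvgD; [exact: cvg_cst|exact: cvg_id].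
exact: (@delta_quotient_cvg _ _ (fun y => F y (Z w))).
Qed.
End GradientMeasurable.

(** * Conditional independence and uncorrelated noise *)

Section AlmostEverywhere.
Context (R : realType) (dO : measure_display) (Omega : measurableType dO)
  (P : probability Omega R).
Implicit Types (f g : Omega -> R) (G : set (set Omega)).

Lemma mean_ae f g : measurable_fun setT f -> measurable_fun setT g ->
  {ae P, forall w, f w = g w} -> mean P f = mean P g.
Proof.
move=> mf mg fg; rewrite /mean /Rintegral; congr fine; apply: ae_eq_integral => //.
- exact/measurable_EFinP.
- exact/measurable_EFinP.
- by apply: filterS fg => w /= ->.
Qed.

(** Test the inequality of integrals on the event where it fails pointwise. *)
Lemma le_ae_of_mean G f g : sub_sigma_field G ->
  measurable_wrt G f -> measurable_wrt G g -> integ P f -> integ P g ->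
  (forall A, G A -> mean P (fun w => \1_A w * f w) <= mean P (fun w => \1_A w * g w)) ->
  {ae P, forall w, f w <= g w}.
Proof.
move=> HG mf mg If Ig Hle; pose E := [set w | g w < f w].
have GE : G E.
  have mfg : measurable_wrt G (fun w => f w - g w) by exact: measurable_funB.
  have := measurable_wrtP HG mfg (measurable_itv `]0, +oo[).
  congr G; apply/seteqP; split => w /=; rewrite /E /= in_itv /= andbT subr_gt0; exact.
have mE : measurable E by exact: (proj2 HG).
pose h w := \1_E w * f w - \1_E w * g w.
have Ih : integ P h by apply: integB; exact: integ_indic.
have h0 w : 0 <= h w.
  rewrite /h -mulrBr indicE; case: (boolP (w \in E)) => [|_]; last by rewrite mul0r.
  by rewrite inE /E /= mul1r subr_ge0 => /ltW.
have mh0 : mean P h = 0.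
  apply/eqP; rewrite eq_le; apply/andP; split; last first.
    by apply: Rintegral_ge0 => w _; exact: h0.
  by rewrite /h meanB; [rewrite subr_le0; exact: Hle|exact: integ_indic|exact: integ_indic].
have : (\int[P]_w `|(EFin \o h) w| = 0)%E.
  have -> : (\int[P]_w `|(EFin \o h) w| = \int[P]_w (h w)%:E)%E.
    by apply: eq_integral => w _; rewrite /= ger0_norm.
  rewrite -[LHS]fineK; first by congr EFin; exact: mh0.
  exact: integrable_fin_num Ih.
move/(ae_eq_integral_abs P measurableT (measurable_int _ Ih)); apply: filterS => w /= /(_ I) [].
rewrite /h -mulrBr indicE; case: (boolP (w \in E)) => [|].
  by rewrite mul1r => _ /eqP; rewrite subr_eq0 => /eqP ->.
by move=> + _; apply: contraNT; rewrite -ltNge inE.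
Qed.
End AlmostEverywhere.

Section Uncorrelated.
Context (R : realType) (dO : measure_display) (Omega : measurableType dO)
  (P : probability Omega R) (G : set (set Omega)) (HG : sub_sigma_field G).
Context (I : finType) (dT : I -> measure_display)
  (T : forall i, measurableType (dT i)) (X : forall i, Omega -> T i).
Hypothesis mX : forall i, measurable_fun setT (X i).
Hypothesis indep : cond_mutual_indep P G X.

Local Notation Ex := (mean P).

(** A pi-system generating the information of [G] together with the sample
    [X i]. *)
Definition joint i : set (set Omega) :=
  [set C | exists A B, [/\ G A, measurable B & C = A `&` X i @^-1` B]].

Lemma joint_setI i : setI_closed (joint i).
Proof.
move=> _ _ [A [B [GA mB ->]]] [A' [B' [GA' mB' ->]]].
exists (A `&` A'), (B `&` B'); split; last by rewrite preimage_setI setIACA.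
- have := HG; case=> sG _; have <- := sigma_algebra_id sG.
  by apply: (@measurableI _ (g_sigma_algebraType G)); rewrite /measurable /= sigma_algebra_id.
- exact: measurableI.
Qed.

Let GT : G setT.
Proof.
case: HG => sG _; rewrite -(sigma_algebra_id sG).
exact: (@measurableT _ (g_sigma_algebraType G)).
Qed.

Let mG A : G A -> measurable A. Proof. by case: HG => _; exact. Qed.

Let mXB i (B : set (T i)) : measurable B -> measurable (X i @^-1` B).
Proof. by move=> mB; rewrite -[X in measurable X]setTI; exact: mX. Qed.

Lemma joint_setT i : joint i setT.
Proof. by exists setT, setT; split; rewrite // preimage_setT setTI. Qed.

Lemma joint_measurable i : joint i `<=` measurable.
Proof. by move=> _ [A [B [GA mB ->]]]; apply: measurableI; [exact: mG|exact: mXB]. Qed.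

Lemma joint_sub_sigma_field i : sub_sigma_field <<s joint i>>.
Proof.
split; first exact: smallest_sigma_algebra.
apply: smallest_sub; last exact: joint_measurable.
exact: sigma_algebra_measurable.
Qed.

Lemma measurable_wrt_joint i d' (S : measurableType d') (U : Omega -> S) :
  measurable_wrt G U -> measurable_wrt <<s joint i>> U.
Proof.
move=> mU _ B mB; rewrite setTI; apply: sub_sigma_algebra; apply: sub_sigma_algebra.
exists (U @^-1` B), setT; split => //; first exact: (measurable_wrtP HG mU).
by rewrite preimage_setT setIT.
Qed.

Lemma measurable_wrt_joint_sample i : measurable_wrt <<s joint i>> (X i).
Proof.
move=> _ B mB; rewrite setTI; apply: sub_sigma_algebra; apply: sub_sigma_algebra.
by exists setT, B; split => //; rewrite setTI.
Qed.

Lemma is_cond_exp_mean Y Z : is_cond_exp P G Y Z -> forall A, G A ->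
  Ex (fun w => \1_A w * Z w) = Ex (fun w => \1_A w * Y w).
Proof. by case=> _ _ _ H A GA; rewrite !mean_indicE H. Qed.

Let ind i (B : set (T i)) : Omega -> R := \1_(X i @^-1` B).

Let mind i (B : set (T i)) : measurable B -> measurable_fun setT (ind B).
Proof. by move=> mB; exact: measurable_indic (mXB mB). Qed.

Let ind01 A (w : Omega) : 0 <= (\1_A w : R) <= 1.
Proof. by rewrite indicE ler0n lern1 leq_b1. Qed.

Let integ_bounded (f : Omega -> R) (M : R) : measurable_fun setT f ->
  (forall w, `|f w| <= M) -> integ P f.
Proof. by move=> mf fM; apply: (integ_le mf fM); exact: integ_cst. Qed.

Lemma cond_exp_ind_unit i B (p : Omega -> R) : measurable B ->
  is_cond_exp P G (ind (i := i) B) p -> {ae P, forall w, 0 <= p w <= 1}.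
Proof.
move=> mB H; have HE := is_cond_exp_mean H; case: H => IB mp Ip _.
have ae0 : {ae P, forall w, 0 <= p w}.
  apply: (le_ae_of_mean HG (f := cst 0)) => //; [exact: measurable_cst|exact: integ_cst|].
  move=> A GA; rewrite HE //; apply: le_mean.
    by apply: integ_indic; [exact: mG|exact: (@integ_cst _ _ _ P 0)].
    by apply: integ_indic => //; exact: mG.
  move=> w; rewrite mulr0; apply: mulr_ge0; first by case/andP: (ind01 A w).
  by case/andP: (ind01 (X i @^-1` B) w).
have ae1 : {ae P, forall w, p w <= 1}.
  apply: (le_ae_of_mean HG (g := cst 1)) => //; [exact: measurable_cst|exact: integ_cst|].
  move=> A GA; rewrite HE //; apply: le_mean; first by apply: integ_indic => //; exact: mG.
    by apply: integ_indic; [exact: mG|exact: (@integ_cst _ _ _ P 1)].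
  move=> w; apply: ler_wpM2l; first by case/andP: (ind01 A w).
  by case/andP: (ind01 (X i @^-1` B) w).
by apply: filterS2 ae0 ae1 => w -> ->.
Qed.

Lemma cond_exp_unique Y p q : is_cond_exp P G Y p -> is_cond_exp P G Y q ->
  {ae P, forall w, p w = q w}.
Proof.
move=> Hp Hq; have Ep := is_cond_exp_mean Hp; have Eq := is_cond_exp_mean Hq.
case: Hp Hq => _ mp Ip _ [_ mq Iq _].
have a1 : {ae P, forall w, p w <= q w}.
  by apply: (le_ae_of_mean HG) => // A GA; rewrite Ep ?Eq.
have a2 : {ae P, forall w, q w <= p w}.
  by apply: (le_ae_of_mean HG) => // A GA; rewrite Ep ?Eq.
by apply: filterS2 a1 a2 => w h1 h2; apply/le_anti; rewrite h1 h2.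
Qed.

(** Used for the samples left unconstrained, so that the product rule for the
    whole family reduces to the product rule for a pair. *)
Lemma cond_exp_indT p : is_cond_exp P G \1_(setT : set Omega) p ->
  {ae P, forall w, p w = 1}.
Proof.
move=> Hp; apply: (cond_exp_unique Hp (q := cst 1)); case: Hp => I1 _ _ _.
split => //; [exact: measurable_cst|exact: integ_cst|].
by move=> A _; apply: eq_integral => w _; rewrite indicE in_setT.
Qed.

(** The versions delivered by conditional independence may change with the events
    prescribed for the other samples.  Almost everywhere uniqueness lets a single
    version, clipped to the unit interval, serve all of them. *)
Lemma cond_prob_version i (B : set (T i)) : measurable B ->
  exists q : Omega -> R, [/\ measurable_wrt G q, forall w, 0 <= q w <= 1 &
    forall j (B' : set (T j)) A, i != j -> measurable B' -> G A ->
      Ex (fun w => \1_A w * (q w * ind B' w)) =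
      Ex (fun w => \1_A w * (ind B w * ind B' w))].
Proof.
move=> mB.
have mT l : measurable (@eqtype.dfwith I (fun l => set (T l)) (fun l => setT) i B l).
  by case: eqtype.dfwithP => // *; exact: measurableT.
have [p0 [Hp0 _]] := indep mT.
have {Hp0} := Hp0 i; rewrite /= dfwith_in => Hp0.
have [_ mp0 _ _] := Hp0.
exists (fun w => Num.max 0 (Num.min 1 (p0 i w))).
set q := fun w => _.
have mq : measurable_wrt G q.
  apply: (@measurable_maxr _ _ _ _ (cst 0)) => //.
  exact: (@measurable_minr _ _ _ _ (cst 1)).
have q01 w : 0 <= q w <= 1.
  by rewrite /q le_max lexx /= ge_max ler01 ge_min lexx.
have qp0 : {ae P, forall w, q w = p0 i w}.
  apply: filterS (cond_exp_ind_unit mB Hp0) => w /andP[h0 h1].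
  by rewrite /q min_r // max_r.
split => // j B' A ij mB' GA.
have mBB l : measurable (@eqtype.dfwith I (fun l => set (T l))
      (@eqtype.dfwith I (fun l => set (T l)) (fun l => setT) i B) j B' l).
  by case: eqtype.dfwithP => // l' _; case: eqtype.dfwithP => // *; exact: measurableT.
have [p [Hp Hprod]] := indep mBB.
have Hpj : is_cond_exp P G (ind B') (p j) by have := Hp j; rewrite /= dfwith_in.
have Hpi : is_cond_exp P G (ind B) (p i).
  by have := Hp i; rewrite /= dfwith_out 1?eq_sym // dfwith_in.
have Hpl l : {ae P, forall w, l != i -> l != j -> p l w = 1}.
  have [->|li] := eqVneq l i; first by apply: aeW => w /=; rewrite ?eqxx.
  have [->|lj] := eqVneq l j; first by apply: aeW => w /= _; rewrite ?eqxx.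
  have := Hp l; rewrite /= !dfwith_out 1?eq_sym // preimage_setT => /cond_exp_indT.
  by apply: filterS => w ->.
have prodE : {ae P, forall w, \prod_l p l w = q w * p j w}.
  have H1 : {ae P, forall w, forall l, l != i -> l != j -> p l w = 1}.
    exact: filter_forall.
  have H2 := cond_exp_unique Hpi Hp0.
  apply: filterS3 H1 H2 qp0 => w Hw pi qw.
  rewrite (bigD1 i) //= (bigD1 j) /=; last by rewrite eq_sym.
  by rewrite big1 ?mulr1 ?pi ?qw // => l /andP[li lj]; exact: Hw.
have [_ mprod Iprod _] := Hprod; have [Ij mpj Ipj _] := Hpj.
have mqO := measurable_wrt_sub HG mq.
have mA := mG GA.
have Iq (f : Omega -> R) : integ P f -> integ P (fun w => \1_A w * q w * f w).
  move=> If; apply: (@integ_le _ _ _ _ _ (fun w => `|f w|)).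
  - apply: measurable_funM; last exact: integ_meas If.
    by apply: measurable_funM => //; exact: measurable_indic.
  - move=> w; rewrite normrM ler_piMl // normrM.
    have /andP[a0 a1] := ind01 A w; have /andP[q0 q1] := q01 w.
    by rewrite !ger0_norm // mulr_ile1.
  - exact: (integrable_norm If).
have E1 : Ex (fun w => \1_A w * (q w * p j w)) = Ex (fun w => \1_A w * (q w * ind B' w)).
  apply/eqP; rewrite -subr_eq0; apply/eqP.
  have IV : integ P (fun w => p j w - ind B' w) by exact: integB.
  have V0 C : G C -> Ex (fun w => \1_C w * (p j w - ind B' w)) = 0.
    move=> GC; rewrite -(subrr (Ex (fun w => \1_C w * ind B' w))).
    rewrite -{1}(is_cond_exp_mean Hpj GC) -meanB; last 2 first.
    - by apply: integ_indic => //; exact: mG.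
    - by apply: integ_indic => //; exact: mG.
    by congr (mean P _); apply/funext => w; rewrite mulrBr.
  have mU : measurable_wrt G (fun w => \1_A w * q w).
    apply: measurable_funM => //; apply: measurable_indic.
    by rewrite /measurable /=; apply: sub_sigma_algebra.
  have := orthogonal_mean HG IV V0 mU (Iq _ IV).
  rewrite -meanB; last 2 first.
  - by have := Iq _ Ipj; congr (integ P _); apply/funext => w; rewrite mulrA.
  - by have := Iq _ Ij; congr (integ P _); apply/funext => w; rewrite mulrA.
  by move=> <-; congr (mean P _); apply/funext => w; ring.
rewrite -E1; transitivity (Ex (fun w => \1_A w * \prod_l p l w)).
  apply: mean_ae.
  - apply: measurable_funM; first exact: measurable_indic.
    by apply: measurable_funM => //; exact: integ_meas Ipj.
  - by apply: measurable_funM; [exact: measurable_indic|exact: integ_meas Iprod].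
  - by apply: filterS prodE => w ->.
rewrite (is_cond_exp_mean Hprod GA); congr (mean P _); apply/funext => w.
congr (_ * _); rewrite /ind !indicE -natrM mulnb; congr (nat_of_bool _)%:R.
apply/idP/andP; rewrite !inE.
  move=> H; have := H i Logic.I; have := H j Logic.I; rewrite /= dfwith_in.
  by rewrite dfwith_out 1?eq_sym // dfwith_in.
move=> [Hi Hj] l _ /=; case: eqtype.dfwithP => // l' _; case: eqtype.dfwithP => //.
Qed.

(** Orthogonality against the past together with [X i] need only be tested on a
    pi-system, that is on an event of the past intersected with [X i \in B]; there
    conditional independence replaces the indicator of [X i \in B] by its
    conditional probability, which belongs to the past. *)
Theorem cond_indep_uncorrelated i j (U V : Omega -> R) : i != j ->
  measurable_wrt <<s joint i>> U -> measurable_wrt <<s joint j>> V ->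
  integ P V -> integ P (fun w => U w * V w) ->
  (forall A, G A -> Ex (fun w => \1_A w * V w) = 0) ->
  Ex (fun w => U w * V w) = 0.
Proof.
move=> ij mU mV IV IUV V0.
apply: (orthogonal_mean (joint_sub_sigma_field i)) => //.
apply: mean_zero_generated => //;
  [exact: joint_setI|exact: joint_setT|exact: joint_measurable|].
move=> _ [A [B [GA mB ->]]].
(* It remains to show that [V] is centred on [A] intersected with [X i \in B].
   With [q] a conditional probability of [X i \in B], the difference [ind B - q]
   is centred on the events known from [G] and [X j], hence orthogonal to [V] on
   [A]; and [V] is orthogonal to [q] on [A], both being tested against [G]. *)
have [q [mq q01 Hq]] := cond_prob_version mB.
have mqO := measurable_wrt_sub HG mq; have mA := mG GA.
have mVO := integ_meas IV.
have b1 w : `|q w| <= 1 by have /andP[h0 h1] := q01 w; rewrite ger0_norm.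
have Iq : integ P q by exact: integ_bounded b1.
have IB : integ P (ind B).
  apply: (@integ_bounded _ 1); first exact: mind.
  by move=> w; have /andP[h0 h1] := ind01 (X i @^-1` B) w; rewrite ger0_norm.
have ID : integ P (fun w => ind B w - q w) by exact: integB.
have bD w : `|ind B w - q w| <= 2.
  apply: le_trans (ler_normB _ _) _.
  have /andP[h0 h1] := ind01 (X i @^-1` B) w; have := b1 w.
  rewrite (ger0_norm h0); move: h1; rewrite -/(ind B w); lra.
have Ibd (f g : Omega -> R) M : measurable_fun setT f -> (forall w, `|f w| <= M) ->
    integ P g -> integ P (fun w => f w * g w).
  move=> mf fM Ig; apply: (@integ_le _ _ _ _ _ (fun w => M * `|g w|)).
  - by apply: measurable_funM => //; exact: integ_meas Ig.
  - by move=> w; rewrite normrM ler_wpM2r.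
  - exact: (integZ M (integrable_norm Ig)).
have bA w : `|\1_A w : R| <= 1 by have /andP[h0 h1] := ind01 A w; rewrite ger0_norm.
have mAi : measurable_fun setT (\1_A : Omega -> R) by exact: measurable_indic.
have D0 C : <<s joint j>> C -> Ex (fun w => \1_C w * (ind B w - q w)) = 0.
  move: C; apply: mean_zero_generated => //;
    [exact: joint_setI|exact: joint_setT|exact: joint_measurable|].
  move=> _ [A' [B' [GA' mB' ->]]].
  have mA' := mG GA'.
  have Ir (f : Omega -> R) : integ P f -> integ P (fun w => \1_A' w * (f w * ind B' w)).
    move=> If; apply: integ_indic => //.
    have -> : (fun w => f w * ind B' w) = (fun w => ind B' w * f w).
      by apply/funext => w; rewrite mulrC.
    by apply: integ_indic => //; exact: mXB.
  transitivity (Ex (fun w => \1_A' w * (ind B w * ind B' w)) -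
                Ex (fun w => \1_A' w * (q w * ind B' w))).
    rewrite -meanB; [|exact: Ir|exact: Ir].
    congr (mean P _); apply/funext => w; rewrite indicI /ind /=; ring.
  by rewrite Hq // subrr.
have mAV : measurable_wrt <<s joint j>> (fun w => \1_A w * V w).
  apply: measurable_funM => //; apply: measurable_wrt_joint.
  by apply: measurable_indic; rewrite /measurable /=; apply: sub_sigma_algebra.
have IAV : integ P (fun w => \1_A w * V w) by exact: integ_indic.
have IAVD : integ P (fun w => \1_A w * V w * (ind B w - q w)).
  have := Ibd _ _ _ (measurable_funB (mind mB) mqO) bD IAV.
  by congr (integ P _); apply/funext => w; rewrite mulrC.
have K1 := orthogonal_mean (joint_sub_sigma_field j) ID D0 mAV IAVD.
have mAq : measurable_wrt G (fun w => \1_A w * q w).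
  apply: measurable_funM => //; apply: measurable_indic.
  by rewrite /measurable /=; apply: sub_sigma_algebra.
have IAq : integ P (fun w => \1_A w * q w * V w).
  apply: (Ibd _ _ 1) => //; first exact: measurable_funM.
  by move=> w; rewrite normrM mulr_ile1.
have K2 := orthogonal_mean HG IV V0 mAq IAq.
rewrite -[RHS](addr0 0) -{1}K1 -K2 -meanD //.
congr (mean P _); apply/funext => w; rewrite indicI /ind /=; ring.
Qed.
End Uncorrelated.

(** * Averages of convex smooth objectives *)

Section Agents.
Context (R : realType) (N d : nat) (f : 'I_N -> 'cV[R]_d -> R) (L : R).
Hypothesis N_gt0 : (0 < N)%N.
Hypothesis L_gt0 : 0 < L.
Hypothesis fdiff : forall i x, differentiable (f i : 'cV[R]_d -> R^o) x.
Hypothesis fconvex : forall i, convex_function (setT : set 'cV[R]_d) (f i : _ -> R^o).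
Hypothesis fsmooth : forall i x y,
  enorm (grad (f i) x - grad (f i) y) <= L * enorm (x - y).
Variable xs : 'cV[R]_d.
Hypothesis xs_min : forall x, N%:R^-1 * \sum_i f i xs <= N%:R^-1 * \sum_i f i x.

Let N0 : 0 < N%:R :> R. Proof. by rewrite ltr0n. Qed.

Lemma sum_avg (v : 'I_N -> 'cV[R]_d) : \sum_i v i = N%:R *: avg v.
Proof. by rewrite /avg scalerA mulfV ?gt_eqF // scale1r. Qed.

Lemma dot0l (v : 'cV[R]_d) : dot 0 v = 0.
Proof. by rewrite -(scale0r v) dotZl mul0r. Qed.

Lemma dot_suml (v : 'I_N -> 'cV[R]_d) w : dot (\sum_i v i) w = \sum_i dot (v i) w.
Proof.
elim/big_rec2: _ => [|i x u _ <-]; first exact: dot0l.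
by rewrite dotDl.
Qed.

(** The variance decomposition of [N] vectors around their average. *)
Lemma sum_dot_center (v : 'I_N -> 'cV[R]_d) :
  \sum_i dot (v i - avg v) (v i - avg v) =
  \sum_i dot (v i) (v i) - N%:R * dot (avg v) (avg v).
Proof.
have E (a : 'cV[R]_d) : \sum_i dot (v i - a) (v i - a) =
    \sum_i dot (v i) (v i) - 2 * dot (\sum_i v i) a + \sum_(i < N) dot a a.
  rewrite dot_suml mulr_sumr -sumrB -big_split /=; apply: eq_bigr => i _.
  by rewrite !dotE [dot a (v i)]dotC; ring.
rewrite E sum_avg dotZl sumr_const card_ord -[_ *+ N]mulr_natl; ring.
Qed.

Lemma dot_avg_le (v : 'I_N -> 'cV[R]_d) :
  N%:R * dot (avg v) (avg v) <= \sum_i dot (v i) (v i).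
Proof.
rewrite -subr_ge0 -sum_dot_center; apply: sumr_ge0 => i _; exact: dot_ge0.
Qed.

(** A gradient step of length [1/L] from [xs] would decrease the average
    objective by [|s|^2 / (2 L)], where [s] is the average gradient. *)
Lemma sum_grad_minimizer : \sum_i grad (f i) xs = 0.
Proof.
set G := \sum_i grad (f i) xs.
pose y := xs - (N%:R^-1 / L) *: G.
have H1 : \sum_i f i xs <= \sum_i f i y.
  by rewrite -(ler_pM2l (_ : 0 < N%:R^-1)) ?invr_gt0 // xs_min.
have H2 : \sum_i f i y <= \sum_i (f i xs + dot (grad (f i) xs) (y - xs)
    + L / 2 * dot (y - xs) (y - xs)).
  by apply: ler_sum => i _; apply: descent.
move: H2; rewrite !big_split /= -dot_suml -/G sumr_const card_ord.
have -> : y - xs = - ((N%:R^-1 / L) *: G) by rewrite /y addrAC subrr add0r.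
rewrite !dotE -[_ *+ N]mulr_natl => H2.
have H3 : N%:R^-1 / L / 2 * dot G G <= 0.
  have -> : N%:R^-1 / L / 2 * dot G G = N%:R^-1 / L * dot G G -
     N%:R * (L / 2 * - - (N%:R^-1 / L * (N%:R^-1 / L * dot G G))).
    by field; rewrite !gt_eqF.
  lra.
have {}H3 : dot G G = 0.
  apply/eqP; rewrite eq_le dot_ge0 andbT.
  by move: H3; rewrite pmulr_rle0 // !divr_gt0 // invr_gt0.
apply/matrixP => c o; rewrite ord1 mxE; apply/eqP; rewrite -sqrf_eq0 eq_le sqr_ge0 andbT.
by rewrite -H3 sqr_coord_le_dot.
Qed.

Variable y : 'I_N -> 'cV[R]_d.
Let yb := avg y.
Let dev := \sum_i dot (y i - yb) (y i - yb).
Let gap := \sum_i (f i yb - f i xs).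

Lemma gap_ge0 : 0 <= gap.
Proof.
rewrite /gap sumrB subr_ge0 -(ler_pM2l (_ : 0 < N%:R^-1)) ?invr_gt0 //.
Qed.

(** Pass through the gradients at the average point: Lipschitz continuity bounds
    the first part, cocoercivity the second, and the linear terms cancel since
    the gradients at the minimizer sum to zero. *)
Lemma sum_grad_dev_le :
  \sum_i dot (grad (f i) (y i) - grad (f i) xs) (grad (f i) (y i) - grad (f i) xs)
  <= 2 * L ^+ 2 * dev + 4 * L * gap.
Proof.
have -> : gap = \sum_i (f i yb - f i xs - dot (grad (f i) xs) (yb - xs)).
  rewrite [RHS]sumrB -dot_suml sum_grad_minimizer.
  by rewrite dot0l subr0.
rewrite /dev !mulr_sumr -big_split /=; apply: ler_sum => i _.
have H1 := cocoercive (fdiff i) L_gt0 (@fsmooth i) (@fconvex i) xs yb.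
have H2 := grad_lipschitz L_gt0 (@fsmooth i) (y i) yb.
move: H1 H2.
have -> : grad (f i) (y i) - grad (f i) xs =
  (grad (f i) (y i) - grad (f i) yb) + (grad (f i) yb - grad (f i) xs).
  by rewrite addrA subrK.
move: (grad (f i) (y i) - grad (f i) yb) (grad (f i) yb - grad (f i) xs) => a b.
move: (dot (y i - yb) _) (f i yb - f i xs - dot _ _) => D C.
move=> H1 H2; have := dot_ge0 (a - b); rewrite !dotE [dot b a]dotC; lra.
Qed.

Variable alpha : R.
Hypothesis alpha_gt0 : 0 < alpha.
Hypothesis alpha_le : alpha <= 1 / (4 * L).

(** The gradients' inner products with [yb - xs] sum to at least the gap minus
    [L/2] times the deviation, by descent towards [yb] and convexity towards
    [xs].  For [alpha <= 1 / (4 L)] the squared length of the step consumes at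
    most half of the decrease [2 alpha gap]. *)
Lemma mean_gradient_step :
  dot (yb - xs - alpha *: avg (fun i => grad (f i) (y i)))
      (yb - xs - alpha *: avg (fun i => grad (f i) (y i)))
  <= dot (yb - xs) (yb - xs) - alpha * (N%:R^-1 * gap)
     + 3 * alpha * L / 2 * (N%:R^-1 * dev).
Proof.
set g := avg _; have a0 := alpha_gt0; have L0 := L_gt0.
have aL : 4 * L * alpha <= 1.
  by move: alpha_le; rewrite ler_pdivlMr ?mulr_gt0 // mulrC.
have H1 : N%:R * dot g g <= 2 * L ^+ 2 * dev + 4 * L * gap.
  apply: le_trans sum_grad_dev_le.
  apply: le_trans (dot_avg_le (fun i => grad (f i) (y i) - grad (f i) xs)).
  by rewrite /avg sumrB sum_grad_minimizer subr0.
have H2 : gap - L / 2 * dev <= N%:R * dot g (yb - xs).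
  rewrite -dotZl -sum_avg dot_suml /gap /dev mulr_sumr -sumrB.
  apply: ler_sum => i _.
  have D := descent (fdiff i) L_gt0 (@fsmooth i) (y i) yb.
  have C := convex_gradient_le (fdiff i) (@fconvex i) (y i) xs.
  have -> : dot (y i - yb) (y i - yb) = dot (yb - y i) (yb - y i).
    by rewrite -opprB dotNl dotNr opprK.
  by move: C D; rewrite !dotDr !dotNr; lra.
have dev0 : 0 <= dev by apply: sumr_ge0 => i _; exact: dot_ge0.
have gap0 := gap_ge0.
move: H1 H2 dev0 gap0; move: gap dev (yb - xs) (g) => Ga De e h H1 H2 De0 Ga0.
rewrite -(ler_pM2l N0) !dotE [dot h e]dotC.
have -> : N%:R * (dot e e - alpha * (N%:R^-1 * Ga) + 3 * alpha * L / 2 * (N%:R^-1 * De)) =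
  N%:R * dot e e - alpha * Ga + 3 * alpha * L / 2 * De.
  by field; rewrite gt_eqF.
have K1 : alpha * (Ga - L / 2 * De) <= alpha * (N%:R * dot h e).
  by rewrite ler_pM2l.
have K2 : alpha * (alpha * (N%:R * dot h h)) <= alpha * (alpha * (2 * L ^+ 2 * De + 4 * L * Ga)).
  by rewrite !ler_pM2l.
have K3 : alpha * Ga * (4 * L * alpha) <= alpha * Ga by rewrite ler_piMr // mulr_ge0 // ltW.
have K4 : alpha * L * De * (4 * L * alpha) <= alpha * L * De.
  by rewrite ler_piMr // !mulr_ge0 // ltW.
rewrite [dot e h]dotC; lra.
Qed.
End Agents.

(** * Square-integrable random vectors *)

Section LinearClosure.
Context (R : realType) (Omega : Type) (C : (Omega -> R) -> Prop).

(** Measurability with respect to a sigma-field and square integrability pass to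
    vectors obtained by linear operations in the same way; both are instances of
    this closure property. *)
Definition lin_closed : Prop := [/\ forall a, C (fun=> a),
  forall f g, C f -> C g -> C (fun w => f w + g w) &
  forall a f, C f -> C (fun w => a * f w)].

Definition coordwise n (v : Omega -> 'cV[R]_n) : Prop :=
  forall c, C (fun w => v w c 0).

Hypothesis HC : lin_closed.

Lemma coordwise_cst n (v : 'cV[R]_n) : coordwise (fun=> v).
Proof. by case: HC => H _ _ c; exact: H. Qed.

Lemma coordwiseD n (u v : Omega -> 'cV[R]_n) :
  coordwise u -> coordwise v -> coordwise (fun w => u w + v w).
Proof.
case: HC => _ H _ Hu Hv c; rewrite (_ : (fun w => _) = fun w => u w c 0 + v w c 0).
  exact: H.
by apply/funext => w; rewrite mxE.
Qed.

Lemma coordwiseZ n a (v : Omega -> 'cV[R]_n) :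
  coordwise v -> coordwise (fun w => a *: v w).
Proof.
case: HC => _ _ H Hv c; rewrite (_ : (fun w => _) = fun w => a * v w c 0).
  exact: H.
by apply/funext => w; rewrite mxE.
Qed.

Lemma coordwiseB n (u v : Omega -> 'cV[R]_n) :
  coordwise u -> coordwise v -> coordwise (fun w => u w - v w).
Proof.
move=> Hu Hv; rewrite (_ : (fun w => _) = fun w => u w + (-1) *: v w).
  by apply: coordwiseD => //; exact: coordwiseZ.
by apply/funext => w; rewrite scaleN1r.
Qed.

Lemma coordwise_sum n (I : Type) (s : seq I) (v : I -> Omega -> 'cV[R]_n) :
  (forall i, coordwise (v i)) -> coordwise (fun w => \sum_(i <- s) v i w).
Proof.
move=> Hv; elim: s => [|i s IH].
  by under eq_fun do rewrite big_nil; exact: coordwise_cst.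
by under eq_fun do rewrite big_cons; exact: coordwiseD.
Qed.

Lemma coordwise_mulmx m n (A : 'M[R]_(m, n)) (v : Omega -> 'cV[R]_n) :
  coordwise v -> coordwise (fun w => A *m v w).
Proof.
move=> Hv c; case: HC => H0 HD HZ.
rewrite (_ : (fun w => _) = fun w => \sum_(j <- index_enum 'I_n) A c j * v w j 0).
  elim: (index_enum _) => [|j s IH]; first by under eq_fun do rewrite big_nil.
  by under eq_fun do rewrite big_cons; apply: HD => //; exact: HZ.
by apply/funext => w; rewrite mxE.
Qed.

Lemma coordwise_stack N d (v : 'I_N -> Omega -> 'cV[R]_d) :
  (forall i, coordwise (v i)) -> coordwise (fun w => stack (fun i => v i w)).
Proof.
move=> Hv c; rewrite (_ : (fun w => _) =
  fun w => v (mxtens_unindex c).1 w (mxtens_unindex c).2 0); first exact: Hv.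
by apply/funext => w; rewrite mxE.
Qed.
End LinearClosure.

Lemma measurable_wrt_lin_closed (R : realType) (dO : measure_display)
  (Omega : measurableType dO) (G : set (set Omega)) :
  lin_closed (fun f : Omega -> R => measurable_wrt G f).
Proof.
split=> [a|f g mf mg|a f mf].
- exact: measurable_cst.
- exact: measurable_funD.
- by apply: measurable_funM => //; exact: measurable_cst.
Qed.

Section SquareIntegrable.
Context (R : realType) (dO : measure_display) (Omega : measurableType dO)
  (P : probability Omega R).

Definition sqint (f : Omega -> R) : Prop :=
  measurable_fun setT f /\ integ P (fun w => f w ^+ 2).

Lemma sqint_le (f g : Omega -> R) : measurable_fun setT f ->
  (forall w, f w ^+ 2 <= g w) -> integ P g -> sqint f.
Proof.
move=> mf fg Ig; split => //; apply: (integ_le _ _ Ig).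
  exact: measurable_funX.
by move=> w; rewrite ger0_norm ?sqr_ge0.
Qed.

Lemma sqint_mul (f g : Omega -> R) : sqint f -> sqint g ->
  integ P (fun w => f w * g w).
Proof.
move=> [mf If] [mg Ig]; apply: (integ_le _ _ (integD If Ig)).
  exact: measurable_funM.
move=> w; rewrite ler_norml; have := sqr_ge0 (f w + g w).
by have := sqr_ge0 (f w - g w); rewrite !expr2; have := sqr_ge0 (f w);
  have := sqr_ge0 (g w); rewrite !expr2 => *; apply/andP; split; lra.
Qed.

Lemma sqint_lin_closed : lin_closed sqint.
Proof.
split=> [a|f g [mf If] [mg Ig]|a f [mf If]].
- by split; [exact: measurable_cst|exact: integ_cst].
- apply: (@sqint_le _ (fun w => 2 * (f w ^+ 2 + g w ^+ 2))).
  + exact: measurable_funD.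
  + by move=> w; have := sqr_ge0 (f w - g w); rewrite !expr2; lra.
  + by apply: integZ; exact: integD.
- apply: (@sqint_le _ (fun w => a ^+ 2 * f w ^+ 2)).
  + by apply: measurable_funM => //; exact: measurable_cst.
  + by move=> w; rewrite exprMn.
  + exact: integZ.
Qed.

Lemma bform_integ n (M : 'M[R]_n) (u v : Omega -> 'cV[R]_n) :
  coordwise sqint u -> coordwise sqint v -> integ P (fun w => bform M (u w) (v w)).
Proof.
move=> Hu Hv; under eq_fun do rewrite bform_sum.
apply: integ_sum => j; apply: integ_sum => i; apply: integZ; exact: sqint_mul.
Qed.

Lemma mean_bform n (M : 'M[R]_n) (u v : Omega -> 'cV[R]_n) :
  coordwise sqint u -> coordwise sqint v ->
  mean P (fun w => bform M (u w) (v w)) =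
  \sum_j \sum_i M i j * mean P (fun w => u w i 0 * v w j 0).
Proof.
move=> Hu Hv; under [in LHS]eq_fun do rewrite bform_sum.
have I2 i j : integ P (fun w => u w i 0 * v w j 0) by exact: sqint_mul.
rewrite mean_sum => [|j]; last by apply: integ_sum => i; exact: integZ.
apply: eq_bigr => j _; rewrite mean_sum => [|i]; last exact: integZ.
by apply: eq_bigr => i _; rewrite meanZ.
Qed.

(** Expanded over coordinates, the form is a combination of products, each of
    mean zero by [orthogonal_mean]. *)
Lemma mean_bform_centred G n (M : 'M[R]_n) (u v : Omega -> 'cV[R]_n) :
  sub_sigma_field G -> coordwise (fun f => measurable_wrt G f) u ->
  coordwise sqint u -> coordwise sqint v ->
  (forall c, integ P (fun w => v w c 0)) ->
  (forall c A, G A -> mean P (fun w => \1_A w * v w c 0) = 0) ->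
  mean P (fun w => bform M (u w) (v w)) = 0 /\
  mean P (fun w => bform M (v w) (u w)) = 0.
Proof.
move=> HG mu Iu Iv I1v v0.
have O i j : mean P (fun w => u w i 0 * v w j 0) = 0.
  by apply: (orthogonal_mean HG (I1v j) (v0 j) (mu i)); exact: sqint_mul.
split; rewrite mean_bform //; apply: big1 => j _; apply: big1 => i _.
  by rewrite O mulr0.
have -> : (fun w => v w i 0 * u w j 0) = (fun w => u w j 0 * v w i 0).
  by apply/funext => w; rewrite mulrC.
by rewrite O mulr0.
Qed.
End SquareIntegrable.

(** * The iteration in stacked form *)

Section Dynamics.
Context (R : realType) (N d : nat) (hN : (0 < N)%N)
  (dX : 'I_N -> measure_display) (Xi : forall i, measurableType (dX i))
  (D : forall i, probability (Xi i) R) (F : forall i, 'cV[R]_d -> Xi i -> R)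
  (dO : measure_display) (Omega : measurableType dO) (P : probability Omega R)
  (xi : nat -> forall i, {RV P >-> Xi i})
  (W : nat -> 'M[R]_N) (hW : forall k, doubly_stochastic (W k))
  (alpha : R) (x0 : 'I_N -> 'cV[R]_d) (x g : nat -> 'I_N -> Omega -> 'cV[R]_d)
  (hgt : gradient_tracking F xi W alpha x0 x g)
  (tau : nat) (lambda : R) (xs : 'cV[R]_d)
  (hxs0 : \sum_i grad (fobj D F i) xs = 0).
Variable w : Omega.

Local Notation sgk k := (fun i => sg F xi x k i w).
Local Notation gk k := (fun i => g k i w).
Local Notation xk k := (fun i => x k i w).
Local Notation gs := (fun i => grad (fobj D F i) xs).
Local Notation W_ k := (lift_mx d (W k)).
Local Notation Wt k := (lift_mx d (wtilde W k)).
Local Notation h k := (stack (sgk k) - stack gs).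
Local Notation eta := (Defs.eta tau lambda).

Lemma sum_mix k (v : 'I_N -> 'cV[R]_d) :
  \sum_i \sum_j W k i j *: v j = \sum_j v j.
Proof.
rewrite exchange_big /=; apply: eq_bigr => j _.
by rewrite -scaler_suml (col_sum1 (hW k)) scale1r.
Qed.

(** Tracking: the mixing step preserves the average, and each new sample enters
    as a difference, so the trackers and the samples keep equal sums. *)
Lemma sum_tracker k : \sum_i g k i w = \sum_i sg F xi x k i w.
Proof.
case: hgt => _ g0 _ gS; elim: k => [|k IH]; first by apply: eq_bigr => i _.
under eq_bigr do rewrite gS; rewrite sumrB big_split /= sum_mix IH.
by rewrite addrAC subrr add0r.
Qed.

Lemma xbarS k : xbar x k.+1 w = xbar x k w - alpha *: avg (sgk k).
Proof.
case: hgt => _ _ xS _; rewrite /xbar /avg.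
under eq_bigr do rewrite xS; rewrite sum_mix sumrB -scaler_sumr sum_tracker.
by rewrite scalerBr scalerA mulrC -scalerA.
Qed.

Lemma stackB (u v : 'I_N -> 'cV[R]_d) :
  stack u - stack v = stack (fun i => u i - v i).
Proof. by apply/matrixP => p o; rewrite ord1 !mxE. Qed.

Lemma stackD (u v : 'I_N -> 'cV[R]_d) :
  stack u + stack v = stack (fun i => u i + v i).
Proof. by apply/matrixP => p o; rewrite ord1 !mxE. Qed.

Lemma stackZ a (v : 'I_N -> 'cV[R]_d) : a *: stack v = stack (fun i => a *: v i).
Proof. by apply/matrixP => p o; rewrite ord1 !mxE. Qed.

Lemma stack_eq (u v : 'I_N -> 'cV[R]_d) : (forall i, u i = v i) -> stack u = stack v.
Proof. by move=> uv; congr stack; apply/funext. Qed.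

Lemma lift_avg_stack (v : 'I_N -> 'cV[R]_d) :
  lift_mx d (avgmx R N) *m stack v = stack (fun=> avg v).
Proof.
rewrite lift_stack; apply: stack_eq => i; rewrite /avg scaler_sumr.
by apply: eq_bigr => j _; rewrite mxE.
Qed.

Lemma xhatE k : xhat x k w = stack (fun i => x k i w - xbar x k w).
Proof. by rewrite /xhat mulmxBl mul1mx lift_avg_stack stackB. Qed.

Lemma dot_xhat k : dot (xhat x k w) (xhat x k w) =
  \sum_i dot (x k i w - xbar x k w) (x k i w - xbar x k w).
Proof. by rewrite xhatE dot_stack. Qed.

(** The shift by the gradients at the minimizer keeps the average equal to zero, so
    that mixing [ytilde] by [W k] or by [wtilde W k] is the same. *)
Lemma avg_ytilde k : lift_mx d (avgmx R N) *m ytilde D F xi xs x g k w = 0.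
Proof.
rewrite /ytilde stackB stackD lift_avg_stack /avg.
rewrite big_split /= sumrB sum_tracker subrr hxs0 addr0 scaler0.
by apply/matrixP => p o; rewrite !mxE.
Qed.

Lemma ytildeS k : ytilde D F xi xs x g k.+1 w =
  Wt k *m ytilde D F xi xs x g k w + (W_ k - 1%:M) *m h k.
Proof.
case: hgt => _ _ _ gS.
have -> : Wt k *m ytilde D F xi xs x g k w = W_ k *m ytilde D F xi xs x g k w.
  by rewrite lift_mxB mulmxBl avg_ytilde subr0.
have -> : ytilde D F xi xs x g k.+1 w = W_ k *m stack (gk k) - stack (sgk k) + stack gs.
  rewrite /ytilde; congr (_ + _); rewrite lift_stack !stackB.
  by apply: stack_eq => i; rewrite gS addrAC addrK.
rewrite /ytilde mulmxBl mul1mx !mulmxDr !mulmxN opprB.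
move: (_ *m stack (gk k)) (_ *m stack (sgk k)) (_ *m stack gs) => a b c.
move: (stack (sgk k)) (stack gs) => e f.
apply/matrixP => p o; rewrite !mxE; ring.
Qed.

Hypothesis eta_gt0 : 0 < eta.

Lemma zvecS k : zvec D F xi alpha tau lambda xs x g k.+1 w =
  Wt k *m zvec D F xi alpha tau lambda xs x g k w
  + (alpha / eta) *: ((W_ k - 1%:M) *m h k).
Proof. by rewrite /zvec ytildeS scalerDr scalemxAr. Qed.

Lemma xhatS k : xhat x k.+1 w =
  Wt k *m (xhat x k w - eta *: zvec D F xi alpha tau lambda xs x g k w - alpha *: h k).
Proof.
case: hgt => _ _ xS _.
have E : 1%:M - lift_mx d (avgmx R N) = lift_mx d (1%:M - avgmx R N) :> 'M[R]_(N * d).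
  by rewrite lift_mxB lift_mx1.
have -> : eta *: zvec D F xi alpha tau lambda xs x g k w = alpha *: ytilde D F xi xs x g k w.
  by rewrite /zvec scalerA mulrCA mulfV ?gt_eqF // mulr1.
have -> : xhat x k w - alpha *: ytilde D F xi xs x g k w - alpha *: h k =
    xhat x k w - alpha *: stack (gk k).
  rewrite -addrA -opprD -scalerDr; congr (_ - _ *: _); rewrite /ytilde.
  move: (stack (gk k)) (stack (sgk k)) (stack gs) => a b c.
  by apply/matrixP => p o; rewrite !mxE; ring.
have -> : xhat x k.+1 w =
    lift_mx d (1%:M - avgmx R N) *m (W_ k *m (stack (xk k) - alpha *: stack (gk k))).
  rewrite /xhat E; congr (_ *m _); rewrite stackZ stackB lift_stack.
  by apply: stack_eq => i; rewrite xS.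
rewrite mulmxA -lift_mxM /xhat E mulmxBl mul1mx avgmx_mull // -/(wtilde W k).
rewrite !mulmxBr mulmxA -lift_mxM; congr (lift_mx d _ *m _ - _).
rewrite mulmxBr mulmx1 /wtilde mulmxBl avgmx_mulr // avgmx_idem // subrr.
by rewrite subr0.
Qed.
End Dynamics.

(** * Expected one-step inequalities *)

Section Estimates.
Context (R : realType) (N d : nat) (hN : (0 < N)%N)
  (dX : 'I_N -> measure_display) (Xi : forall i, measurableType (dX i))
  (D : forall i, probability (Xi i) R)
  (F : forall i, 'cV[R]_d -> Xi i -> R)
  (hFint : forall i x, (D i).-integrable setT (EFin \o F i x))
  (hFdiff : forall i (s : Xi i) (x : 'cV[R]_d),
     differentiable (fun y : 'cV[R]_d => F i y s : R^o) x)
  (L : R) (hL : 0 < L)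
  (hfdiff : forall i (x : 'cV[R]_d),
     differentiable (fobj D F i : 'cV[R]_d -> R^o) x)
  (hfconvex : forall i,
     convex_function (setT : set 'cV[R]_d) (fobj D F i))
  (hfsmooth : forall i (x y : 'cV[R]_d),
     enorm (grad (fobj D F i) x - grad (fobj D F i) y) <= L * enorm (x - y))
  (xs : 'cV[R]_d) (hxs : forall x, favg D F xs <= favg D F x)
  (W : nat -> 'M[R]_N) (hW : forall k, doubly_stochastic (W k))
  (tau : nat) (htau : (1 <= tau)%N)
  (lambda : R) (hlambda : 0 <= lambda < 1)
  (hcontr : forall k, opnorm2 (mxchain (wtilde W) (k + tau) k) <= lambda)
  (dO : measure_display) (Omega : measurableType dO) (P : probability Omega R)
  (xi : nat -> forall i, {RV P >-> Xi i})
  (alpha : R) (x0 : 'I_N -> 'cV[R]_d)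
  (x g : nat -> 'I_N -> Omega -> 'cV[R]_d)
  (hgt : gradient_tracking F xi W alpha x0 x g)
  (calF : nat -> set (set Omega)) (hcalF : forall k, sub_sigma_field (calF k))
  (hx_meas : forall k l i, (l <= k)%N -> vmeasurable_wrt (calF k) (x l i))
  (hg_meas : forall k l i, (l < k)%N -> vmeasurable_wrt (calF k) (g l i))
  (hxi_meas : forall k l i, (l < k)%N -> measurable_wrt (calF k) (xi l i))
  (hindep : forall k, cond_mutual_indep P (calF k) (fun i => xi k i : Omega -> Xi i))
  (hunbiased : forall k i (j : 'I_d),
     is_cond_exp P (calF k) (fun w => noise D F xi x k i w j 0) (cst 0))
  (sigma : R)
  (hvar : forall k i, exists V : Omega -> R,
     is_cond_exp P (calF k) (fun w => enorm (noise D F xi x k i w) ^+ 2) V /\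
     {ae P, forall w, V w <= sigma ^+ 2})
  (halpha : 0 < alpha <= 1 / (4 * L)).

Local Notation f i := (fobj D F i).
Local Notation nz k i := (noise D F xi x k i).
Local Notation sqint := (sqint P).
Local Notation Ex := (mean P).
Local Notation meas_wrt k := (fun f : Omega -> R => measurable_wrt (calF k) f).
Local Notation z := (zvec D F xi alpha tau lambda xs x g).
Local Notation eta := (Defs.eta tau lambda).
Local Notation del := (delta tau lambda).
Local Notation Q := (Qconst tau lambda).

Let N0 : 0 < N%:R :> R. Proof. by rewrite ltr0n. Qed.
Let alpha_gt0 : 0 < alpha. Proof. by case/andP: halpha. Qed.

Let xs_min y : N%:R^-1 * \sum_i f i xs <= N%:R^-1 * \sum_i f i y.
Proof. exact: hxs. Qed.

Let grad0 : \sum_i grad (f i) xs = 0.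
Proof. exact: (sum_grad_minimizer hN hL hfdiff hfsmooth xs_min). Qed.

(** ** Measurability *)

Lemma sample_grad_measurable dT (T : measurableType dT) i (c : 'I_d)
    (X : T -> 'cV[R]_d) (Z : T -> Xi i) :
  (forall j, measurable_fun setT (fun w => X w j 0)) -> measurable_fun setT Z ->
  measurable_fun setT (fun w => sgrad F (X w) (Z w) c 0).
Proof.
move=> mX mZ; rewrite /sgrad.
apply: (@grad_measurable _ _ _ _ _ _ X Z mX mZ (@F i) c) => [s y|y]; first exact: hFdiff.
by have /integrableP[/measurable_EFinP] := hFint i y.
Qed.

Lemma objective_grad_measurable dT (T : measurableType dT) i (c : 'I_d)
    (X : T -> 'cV[R]_d) :
  (forall j, measurable_fun setT (fun w => X w j 0)) ->
  measurable_fun setT (fun w => grad (f i) (X w) c 0).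
Proof.
move=> mX.
apply: (grad_measurable mX (@measurable_id _ T setT) c (F := fun y _ => f i y)) => //.
Qed.

(** The noise of agent [i] depends only on the past and on its own sample. *)
Lemma noise_joint_measurable k i c :
  measurable_wrt <<s joint (calF k) (fun i => xi k i : Omega -> Xi i) i>>
    (fun w => nz k i w c 0).
Proof.
have mX j : measurable_wrt <<s joint (calF k) (fun i => xi k i : Omega -> Xi i) i>>
    (fun w => x k i w j 0).
  by apply: measurable_wrt_joint => //; exact: (@hx_meas k k i (leqnn k) j).
have mZ : measurable_wrt <<s joint (calF k) (fun i => xi k i : Omega -> Xi i) i>>
    (xi k i : Omega -> Xi i) by exact: (measurable_wrt_joint_sample (hcalF k)).
have -> : (fun w => nz k i w c 0) =
    (fun w => sg F xi x k i w c 0 - grad (f i) (x k i w) c 0).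
  by apply/funext => w; rewrite !mxE.
apply: measurable_funB; last exact: objective_grad_measurable.
exact: sample_grad_measurable.
Qed.

Lemma sg_measurable k l i c : (l < k)%N ->
  measurable_wrt (calF k) (fun w => sg F xi x l i w c 0).
Proof.
move=> lk; apply: (@sample_grad_measurable _ (g_sigma_algebraType (calF k))).
  by move=> j; exact: (@hx_meas k l i (ltnW lk) j).
exact: hxi_meas.
Qed.

Lemma objective_grad_dev_measurable k i :
  coordwise (meas_wrt k) (fun w => grad (f i) (x k i w) - grad (f i) xs).
Proof.
apply: coordwiseB; first exact: measurable_wrt_lin_closed.
  move=> c; apply: (@objective_grad_measurable _ (g_sigma_algebraType (calF k))).
  by move=> j; exact: (@hx_meas k k i (leqnn k) j).
apply: coordwise_cst; exact: measurable_wrt_lin_closed.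
Qed.

(** ** Square integrability *)

Lemma noise_integ k i c : integ P (fun w => nz k i w c 0).
Proof. by case: (hunbiased k i c). Qed.

Lemma noise_sqr_integ k i : integ P (fun w => dot (nz k i w) (nz k i w)).
Proof.
have [V [[IV _ _ _] _]] := hvar k i.
by under eq_fun do rewrite -enorm_sqr.
Qed.

Lemma noise_sqint k i : coordwise sqint (fun w => nz k i w).
Proof.
move=> c; apply: sqint_le (noise_sqr_integ k i).
  exact: integ_meas (noise_integ k i c).
by move=> w; exact: sqr_coord_le_dot.
Qed.

Lemma noise_centred k i c A : calF k A -> Ex (fun w => \1_A w * nz k i w c 0) = 0.
Proof.
move=> FA; rewrite -(is_cond_exp_mean (hunbiased k i c) FA).
by under eq_fun do rewrite mulr0; exact: mean_cst.
Qed.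

Lemma calF_setT k : calF k setT.
Proof.
case: (hcalF k) => sG _; rewrite -(sigma_algebra_id sG).
exact: (@measurableT _ (g_sigma_algebraType (calF k))).
Qed.

(** Integrate the bound on a version of the conditional variance. *)
Lemma mean_noise_sqr_le k i : Ex (fun w => dot (nz k i w) (nz k i w)) <= sigma ^+ 2.
Proof.
have [V [HV Vs]] := hvar k i.
have E (h : Omega -> R) : Ex h = Ex (fun w => \1_setT w * h w).
  by congr (mean P _); apply/funext => w; rewrite indicE in_setT mul1r.
have -> : Ex (fun w => dot (nz k i w) (nz k i w)) = Ex V.
  rewrite E [RHS]E (is_cond_exp_mean HV (calF_setT k)).
  by congr (mean P _); apply/funext => w; rewrite enorm_sqr.
case: HV => _ _ IV _.
have mV := integ_meas IV.
rewrite (@mean_ae _ _ _ P V (fun w => Num.min (V w) (sigma ^+ 2))) //; last 2 first.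
- by apply: measurable_minr => //; exact: measurable_cst.
- by apply: filterS Vs => w Vw; rewrite min_l.
rewrite -[leRHS](mean_cst P); apply: le_mean; last by move=> w; rewrite ge_min lexx orbT.
  apply: (@integ_le _ _ _ _ _ (fun w => `|V w| + sigma ^+ 2)).
  - by apply: measurable_minr => //; exact: measurable_cst.
  - move=> w; have s0 := sqr_ge0 sigma; case: (leP (V w) (sigma ^+ 2)) => _.
      by rewrite lerDl.
    by rewrite ger0_norm // lerDr.
  - by apply: integD; [exact: integrable_norm|exact: integ_cst].
exact: integ_cst.
Qed.

(** A Lipschitz gradient grows at most linearly. *)
Lemma objective_grad_sqint i (v : Omega -> 'cV[R]_d) : coordwise sqint v ->
  coordwise sqint (fun w => grad (f i) (v w)).
Proof.
move=> Hv c.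
apply: (@sqint_le _ _ _ _ _ (fun w => 2 * L ^+ 2 * dot (v w) (v w)
    + 2 * dot (grad (f i) 0) (grad (f i) 0))).
- by apply: objective_grad_measurable => j; case: (Hv j).
- move=> w; apply: le_trans (sqr_coord_le_dot _ _) _.
  have := grad_lipschitz hL (@hfsmooth i) (v w) 0; rewrite subr0.
  move: (grad (f i) (v w)) (grad (f i) 0) => a b.
  have := dot_ge0 (a - 2 *: b); rewrite !dotE [dot b a]dotC; lra.
- by apply: integD; [apply: integZ; exact: bform_integ|exact: integ_cst].
Qed.

Let sq_lin := sqint_lin_closed P.

Lemma sg_sqint k i : coordwise sqint (x k i) -> coordwise sqint (sg F xi x k i).
Proof.
move=> Hx; have -> : sg F xi x k i = (fun w => nz k i w + grad (f i) (x k i w)).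
  by apply/funext => w; rewrite /noise subrK.
apply: coordwiseD => //; first exact: noise_sqint.
exact: objective_grad_sqint.
Qed.

(** The start is deterministic, the noise has a finite second moment, and the
    recursion is linear in the iterates, trackers and sampled gradients. *)
Lemma iterates_sqint k :
  (forall i, coordwise sqint (x k i)) /\ (forall i, coordwise sqint (g k i)).
Proof.
case: hgt => x00 g00 xS gS; elim: k => [|k [IHx IHg]].
  have H0 i : coordwise sqint (x 0%N i).
    have -> : x 0%N i = (fun=> x0 i) by apply/funext => w.
    exact: coordwise_cst.
  split=> // i; have -> : g 0%N i = sg F xi x 0%N i by apply/funext => w.
  exact: sg_sqint.
have Hx i : coordwise sqint (x k.+1 i).
  have -> : x k.+1 i = (fun w => \sum_(j < N) W k i j *: (x k j w - alpha *: g k j w)).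
    by apply/funext => w.
  apply: coordwise_sum => // j; apply: coordwiseZ => //; apply: coordwiseB => //.
  exact: coordwiseZ.
split=> // i; have -> : g k.+1 i = (fun w =>
    \sum_(j < N) W k i j *: g k j w + sg F xi x k.+1 i w - sg F xi x k i w).
  by apply/funext => w.
apply: coordwiseB => //; last exact: sg_sqint.
apply: coordwiseD => //; last exact: sg_sqint.
by apply: coordwise_sum => // j; exact: coordwiseZ.
Qed.

Let x_sqint k i : coordwise sqint (x k i). Proof. by case: (iterates_sqint k). Qed.

Lemma xbar_sqint k : coordwise sqint (xbar x k).
Proof. by apply: coordwiseZ => //; apply: coordwise_sum => // i; exact: x_sqint. Qed.

Lemma xhat_sqint k : coordwise sqint (xhat x k).
Proof.
by apply: coordwise_mulmx => //; apply: coordwise_stack => i; exact: x_sqint.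
Qed.

Lemma zvec_sqint k : coordwise sqint (z k).
Proof.
have [_ Hg] := iterates_sqint k.
apply: coordwiseZ => //; apply: coordwiseD => //; last exact: coordwise_cst.
apply: coordwiseB => //; apply: coordwise_stack => i //.
by apply: sg_sqint; exact: x_sqint.
Qed.

Lemma xbar_measurable k : coordwise (meas_wrt k) (xbar x k).
Proof.
apply: coordwiseZ; first exact: measurable_wrt_lin_closed.
apply: coordwise_sum; first exact: measurable_wrt_lin_closed.
by move=> i; exact: hx_meas.
Qed.

Lemma xhat_measurable k : coordwise (meas_wrt k) (xhat x k).
Proof.
apply: coordwise_mulmx; first exact: measurable_wrt_lin_closed.
by apply: coordwise_stack => i; exact: hx_meas.
Qed.

(** The tracking error [z k] involves samples up to time [k - 1] only. *)
Lemma zvec_measurable k : coordwise (meas_wrt k) (z k).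
Proof.
have mlin l := @measurable_wrt_lin_closed R _ _ (calF l).
case: k => [|k].
  case: hgt => _ g00 _ _.
  have -> : z 0%N = fun=> (alpha / eta) *: stack (fun i => grad (f i) xs).
    apply/funext => w; rewrite /zvec /ytilde; congr (_ *: _).
    rewrite (_ : stack (fun i => g 0%N i w) = stack (fun i => sg F xi x 0%N i w)).
      by rewrite subrr add0r.
    by apply: stack_eq => i.
  exact: coordwise_cst.
have sgm : coordwise (meas_wrt k.+1) (fun w => stack (fun i => sg F xi x k i w)).
  by apply: coordwise_stack => i c; exact: sg_measurable.
have gm : coordwise (meas_wrt k.+1) (fun w => stack (fun i => g k i w)).
  by apply: coordwise_stack => i; exact: hg_meas.
have -> : z k.+1 = (fun w => (alpha / eta) *: (lift_mx d (wtilde W k) *m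
     (stack (fun i => g k i w) - stack (fun i => sg F xi x k i w)
       + stack (fun i => grad (f i) xs))
   + (lift_mx d (W k) - 1%:M) *m (stack (fun i => sg F xi x k i w)
       - stack (fun i => grad (f i) xs)))).
  by apply/funext => w; rewrite /zvec (ytildeS hW hgt grad0).
have cst_m : coordwise (meas_wrt k.+1) (fun _ : Omega => stack (fun i => grad (f i) xs)).
  exact: coordwise_cst.
apply: coordwiseZ => //; apply: coordwiseD => //; apply: coordwise_mulmx => //.
  by apply: coordwiseD => //; exact: coordwiseB.
exact: coordwiseB.
Qed.

(** ** The distance to the minimizer *)
Definition noise_stack k w := stack (fun i => nz k i w).
Definition grad_dev_stack k w := stack (fun i => grad (f i) (x k i w) - grad (f i) xs).

Lemma noise_stack_sqint k : coordwise sqint (noise_stack k).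
Proof. by apply: coordwise_stack => i; exact: noise_sqint. Qed.

Lemma grad_dev_stack_sqint k : coordwise sqint (grad_dev_stack k).
Proof.
apply: coordwise_stack => i; apply: coordwiseB => //; last exact: coordwise_cst.
by apply: objective_grad_sqint; exact: x_sqint.
Qed.

Lemma grad_dev_stack_measurable k : coordwise (meas_wrt k) (grad_dev_stack k).
Proof. by apply: coordwise_stack => i; exact: objective_grad_dev_measurable. Qed.

Lemma noise_stack_integ k c : integ P (fun w => noise_stack k w c 0).
Proof.
by under eq_fun do rewrite mxE; exact: noise_integ.
Qed.

Lemma noise_stack_centred k c A : calF k A ->
  Ex (fun w => \1_A w * noise_stack k w c 0) = 0.
Proof.
move=> FA; rewrite -(noise_centred (mxtens_unindex c).1 (mxtens_unindex c).2 FA).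
by congr (mean P _); apply/funext => w; rewrite mxE.
Qed.

Lemma mean_noise_stack_le k :
  Ex (fun w => dot (noise_stack k w) (noise_stack k w)) <= N%:R * sigma ^+ 2.
Proof.
under eq_fun do rewrite dot_stack.
rewrite mean_sum => [|i]; last exact: noise_sqr_integ.
apply: le_trans (ler_sum _ (fun i _ => mean_noise_sqr_le k i)) _.
by rewrite sumr_const card_ord -[leLHS]mulr_natl.
Qed.

(** Conditional independence enters here: the cross terms between different
    agents vanish, so averaging divides the noise variance by [N]. *)
Lemma mean_avg_noise_le k :
  Ex (fun w => dot (avg (fun i => nz k i w)) (avg (fun i => nz k i w)))
    <= sigma ^+ 2 / N%:R.
Proof.
have Inn i j : integ P (fun w => dot (nz k i w) (nz k j w)).
  by apply: bform_integ; exact: noise_sqint.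
have E : (fun w => dot (avg (fun i => nz k i w)) (avg (fun i => nz k i w))) =
    (fun w => N%:R^-1 ^+ 2 * \sum_i \sum_j dot (nz k i w) (nz k j w)).
  apply/funext => w; rewrite /avg dotZl dotZr mulrA -expr2; congr (_ * _).
  rewrite dot_suml; apply: eq_bigr => i _; rewrite dotC dot_suml.
  by apply: eq_bigr => j _; rewrite dotC.
rewrite E meanZ; last by apply: integ_sum => i; apply: integ_sum => j.
rewrite mean_sum => [|i]; last by apply: integ_sum => j.
have H i : Ex (fun w => \sum_j dot (nz k i w) (nz k j w)) <= sigma ^+ 2.
  rewrite mean_sum // (bigD1 i) //= big1 ?addr0; first exact: mean_noise_sqr_le.
  move=> j ji; under eq_fun do rewrite dot_sum.
  rewrite mean_sum => [|c]; last by apply: sqint_mul; exact: noise_sqint.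
  apply: big1 => c _.
  apply: (@cond_indep_uncorrelated _ _ _ _ _ (hcalF k) _ _ _ _
    (fun i => @measurable_funPT _ _ _ _ (xi k i))
    (@hindep k) i j).
  - by rewrite eq_sym.
  - exact: noise_joint_measurable.
  - exact: noise_joint_measurable.
  - exact: noise_integ.
  - by apply: sqint_mul; exact: noise_sqint.
  - by move=> A; exact: noise_centred.
apply: le_trans (ler_wpM2l _ (ler_sum _ (fun i _ => H i))) _; first exact: sqr_ge0.
rewrite sumr_const card_ord -[_ *+ N]mulr_natl le_eqVlt; apply/orP; left; apply/eqP.
by field; rewrite gt_eqF.
Qed.

Definition opt_gap k w := favg D F (xbar x k w) - favg D F xs.
Definition error_energy k w := dot (xhat x k w) (xhat x k w) + 2 * dot (z k w) (z k w).
Definition lyapunov_value k w := qform (Rmx d W tau lambda k) (xhat x k w)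
  + 2 * qform (Rmx d W tau lambda k) (z k w).

Lemma opt_gapE k w : opt_gap k w = N%:R^-1 * \sum_i (f i (xbar x k w) - f i xs).
Proof. by rewrite /opt_gap /favg -mulrBr sumrB. Qed.

(** The gap lies between zero and a quadratic function of the mean iterate. *)
Lemma opt_gap_integ k : integ P (opt_gap k).
Proof.
have I2 : integ P (fun w => dot (xbar x k w - xs) (xbar x k w - xs)).
  apply: bform_integ; apply: coordwiseB => //; try exact: xbar_sqint;
    exact: coordwise_cst.
apply: (@integ_le _ _ _ _ _ (fun w => L / 2 * dot (xbar x k w - xs) (xbar x k w - xs))).
- have mb j : measurable_fun setT (fun w => xbar x k w j 0).
    by case: (@xbar_sqint k j).
  have mf i : measurable_fun setT (fun w => f i (xbar x k w)).
    apply: (@caratheodory_comp_measurable _ _ _ _ _ _ _ _ mb (@measurable_id _ Omega setT)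
      (fun y _ => f i y)) => [_ y|y]; last exact: measurable_cst.
    exact: (differentiable_continuous (hfdiff i y)).
  apply: measurable_funB; last exact: measurable_cst.
  by apply: measurable_funM => //; exact: measurable_sum.
- move=> w; rewrite opt_gapE.
  have g0 := gap_ge0 hN xs_min (fun i => x k i w).
  rewrite ger0_norm ?mulr_ge0 ?invr_ge0 ?ler0n // ler_pdivrMl //.
  have -> : N%:R * (L / 2 * dot (xbar x k w - xs) (xbar x k w - xs)) =
     \sum_i (dot (grad (f i) xs) (xbar x k w - xs)
        + L / 2 * dot (xbar x k w - xs) (xbar x k w - xs)).
    rewrite big_split /= -dot_suml grad0 dot0l add0r sumr_const card_ord.
    by rewrite mulr_natl.
  apply: ler_sum => i _.
  have := descent (hfdiff i) hL (@hfsmooth i) xs (xbar x k w); lra.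
- exact: integZ.
Qed.

Lemma mean_comb5 (f1 f2 f3 f4 f5 : Omega -> R) (c2 c3 c4 c5 : R) :
  integ P f1 -> integ P f2 -> integ P f3 -> integ P f4 -> integ P f5 ->
  let h w := f1 w + (c2 * f2 w + (c3 * f3 w + (c4 * f4 w + c5 * f5 w))) in
  integ P h /\
  Ex h = Ex f1 + (c2 * Ex f2 + (c3 * Ex f3 + (c4 * Ex f4 + c5 * Ex f5))).
Proof.
move=> I1 I2 I3 I4 I5 h.
have J2 := integZ c2 I2; have J3 := integZ c3 I3; have J4 := integZ c4 I4.
have J5 := integZ c5 I5; have J45 := integD J4 J5; have J345 := integD J3 J45.
have J2345 := integD J2 J345.
by split; [exact: integD|rewrite /h !meanD ?meanZ].
Qed.

Lemma error_energy_integ k : integ P (error_energy k).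
Proof.
apply: integD; last apply: integZ; apply: bform_integ.
- exact: xhat_sqint.
- exact: xhat_sqint.
- exact: zvec_sqint.
- exact: zvec_sqint.
Qed.

Lemma lyapunov_value_integ k : integ P (lyapunov_value k).
Proof.
apply: integD; last apply: integZ; apply: bform_integ.
- exact: xhat_sqint.
- exact: xhat_sqint.
- exact: zvec_sqint.
- exact: zvec_sqint.
Qed.

Definition sq_dist k w := dot (xbar x k w - xs) (xbar x k w - xs).

Lemma xbar_error_sqint k : coordwise sqint (fun w => xbar x k w - xs).
Proof. by apply: coordwiseB => //; [exact: xbar_sqint|exact: coordwise_cst]. Qed.

Lemma sq_dist_integ k : integ P (sq_dist k).
Proof. by rewrite /sq_dist; apply: bform_integ; exact: xbar_error_sqint. Qed.

(** The exact part of the step is [mean_gradient_step]; the term linear in the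
    noise has mean zero because the exact part is known before sampling. *)
Lemma mean_dist_step k :
  Ex (sq_dist k.+1) <= Ex (sq_dist k) - alpha * Ex (opt_gap k)
    + 3 * alpha * L / 2 * (N%:R^-1 * Ex (error_energy k)) + alpha ^+ 2 * sigma ^+ 2 / N%:R.
Proof.
pose nb w := avg (fun i => nz k i w).
pose a w := xbar x k w - xs - alpha *: avg (fun i => grad (f i) (x k i w)).
have nb_sq : coordwise sqint nb.
  by apply: coordwiseZ => //; apply: coordwise_sum => // i; exact: noise_sqint.
have a_sq : coordwise sqint a.
  apply: coordwiseB => //; first exact: xbar_error_sqint.
  apply: coordwiseZ => //; apply: coordwiseZ => //.
  by apply: coordwise_sum => // i; apply: objective_grad_sqint; exact: x_sqint.
have mlin := @measurable_wrt_lin_closed R _ _ (calF k).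
have a_meas : coordwise (meas_wrt k) a.
  apply: coordwiseB => //.
    by apply: coordwiseB => //; [exact: xbar_measurable|exact: coordwise_cst].
  apply: coordwiseZ => //; apply: coordwiseZ => //; apply: coordwise_sum => // i c.
  apply: (@objective_grad_measurable _ (g_sigma_algebraType (calF k))).
  by move=> j; exact: (@hx_meas k k i (leqnn k) j).
have nbE c : (fun w => nb w c 0) = (fun w => N%:R^-1 * \sum_i nz k i w c 0).
  by apply/funext => w; rewrite mxE summxE.
have nb_int c : integ P (fun w => nb w c 0).
  by rewrite nbE; apply: integZ; apply: integ_sum => i; exact: noise_integ.
have nb_centred c A : calF k A -> Ex (fun w => \1_A w * nb w c 0) = 0.
  move=> FA; have mA : measurable A by exact: (proj2 (hcalF k)).
  have -> : (fun w => \1_A w * nb w c 0) =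
      (fun w => N%:R^-1 * \sum_i (\1_A w * nz k i w c 0)).
    by apply/funext => w; rewrite mxE summxE -mulr_sumr mulrCA.
  have Ii i : integ P (fun w => \1_A w * nz k i w c 0).
    by apply: integ_indic => //; exact: noise_integ.
  rewrite meanZ; last exact: integ_sum.
  by rewrite mean_sum // big1 ?mulr0 // => i _; exact: noise_centred.
have [C1 C2] := mean_bform_centred 1%:M (hcalF k) a_meas a_sq nb_sq nb_int nb_centred.
pose cross w := dot (a w) (nb w) + dot (nb w) (a w).
have Icross : integ P cross by apply: integD; apply: bform_integ.
have Inb : integ P (fun w => dot (nb w) (nb w)) by exact: bform_integ.
have [Ih Eh] := mean_comb5 (- alpha) (3 * alpha * L / 2 * N%:R^-1) (- alpha) (alpha ^+ 2)
  (sq_dist_integ k) (opt_gap_integ k) (error_energy_integ k) Icross Inb.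
have Ec : Ex cross = 0 by rewrite meanD ?C1 ?C2 ?addr0 //; exact: bform_integ.
have point w : sq_dist k.+1 w <= sq_dist k w + (- alpha * opt_gap k w
    + (3 * alpha * L / 2 * N%:R^-1 * error_energy k w
    + (- alpha * cross w + alpha ^+ 2 * dot (nb w) (nb w)))).
  have E : xbar x k.+1 w - xs = a w - alpha *: nb w.
    have -> : xbar x k.+1 w = xbar x k w
        - alpha *: (avg (fun i => grad (f i) (x k i w)) + nb w).
      rewrite (xbarS hW hgt); congr (_ - _ *: _).
      rewrite /nb /avg -scalerDr -big_split; congr (_ *: _); apply: eq_bigr => i _.
      by rewrite /noise /= addrC subrK.
    rewrite /a; move: (xbar x k w) (avg _) (nb w) => u v v'.
    by apply/matrixP => p o; rewrite !mxE; ring.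
  have al : alpha <= 1 / (4 * L) by case/andP: halpha.
  have := mean_gradient_step hN hL hfdiff hfconvex hfsmooth xs_min (fun i => x k i w)
    alpha_gt0 al.
  rewrite -/(xbar x k w) -/(a w) -/(sq_dist k w) -opt_gapE -dot_xhat => H.
  have H2 : 0 <= 3 * alpha * L / 2 * (N%:R^-1 * dot (z k w) (z k w)).
    have a0 := ltW alpha_gt0; have l0 := ltW hL.
    by rewrite !mulr_ge0 ?invr_ge0 ?ler0n ?dot_ge0.
  rewrite {1}/sq_dist E /cross /error_energy; move: H H2.
  move: (a w) (nb w) (sq_dist k w) (opt_gap k w) (dot (xhat x k w) _) (dot (z k w) _).
  move=> u v D0 G0 X0 Z0; rewrite !dotE; lra.
apply: le_trans (le_mean (sq_dist_integ k.+1) Ih point) _; rewrite Eh Ec.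
have := ler_wpM2l (sqr_ge0 alpha) (mean_avg_noise_le k); rewrite -/(nb _); lra.
Qed.

(** ** The consensus and tracking errors *)
Local Notation mixing := (fun l => lift_mx d (wtilde W l)).
Local Notation A l := (lift_mx d (wtilde W l)).

Lemma mixing_le l v : dot (A l *m v) (A l *m v) <= dot v v.
Proof.
rewrite -[leRHS]mul1r; apply: lift_mx_bound => u; rewrite mul1r.
by apply: wtilde_le => //; exact: hW.
Qed.

Lemma mixing_chain_le l r u : dot (mxchain (wtilde W) (l + r) l *m u)
    (mxchain (wtilde W) (l + r) l *m u) <= dot u u.
Proof.
elim: r => [|r IH]; first by rewrite addn0 mxchain_nil mul1mx.
rewrite addnS mxchainSr ?leq_addr // -mulmxA.
by apply: le_trans IH; exact: wtilde_le.
Qed.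

Lemma mixing_contr l v : dot (mxchain mixing (l + tau) l *m v) (mxchain mixing (l + tau) l *m v)
  <= lambda ^+ 2 * dot v v.
Proof.
rewrite mxchain_lift ?leq_addr //; apply: lift_mx_bound => u.
apply: opnorm2_le => //; first by case/andP: hlambda.
by move=> u'; exact: mixing_chain_le.
Qed.

Let RmxE k : Rmx d W tau lambda k = lyap mixing tau lambda k. Proof. by []. Qed.

Lemma eta_gt0 : 0 < eta.
Proof.
rewrite /Defs.eta divr_gt0 ?mulr_gt0 ?ltr0n // subr_gt0.
by case/andP: hlambda.
Qed.

(** [delta = 2 (1 + lambda) eta]. *)
Lemma eta_le : 2 * eta <= del.
Proof.
have t0 : 0 < tau%:R :> R by rewrite ltr0n.
have -> : del = 2 * eta * (1 + lambda) by rewrite /Defs.eta /delta; field; rewrite gt_eqF.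
have l0 : 0 <= lambda by case/andP: hlambda.
by rewrite ler_peMr ?lerDl // mulr_ge0 // (ltW eta_gt0).
Qed.

(** Outcome by outcome, [quadratic_step] bounds the noiseless part, which is known
    before sampling; the noise adds a centred cross term and a quadratic part,
    whose coefficient [alpha^2 (1 + 2 * 4 / eta^2)] is [alpha^2 Q]. *)
Lemma mean_lyap_step k :
  N%:R^-1 * Ex (lyapunov_value k.+1) <= N%:R^-1 * Ex (lyapunov_value k)
    - del / 4 * (N%:R^-1 * Ex (error_energy k))
    + 20 * alpha ^+ 2 * Q * L / del * Ex (opt_gap k)
    + 10 * alpha ^+ 2 * Q * L ^+ 2 / del * (N%:R^-1 * Ex (error_energy k))
    + alpha ^+ 2 * Q * sigma ^+ 2.
Proof.
have d0 := delta_gt0 htau hlambda; have a0 := alpha_gt0; have e0 := eta_gt0.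
have Q0 : 0 < Q.
  by rewrite /Qconst ltr_pwDl // divr_ge0 // sqr_ge0.
have Dsq := grad_dev_stack_sqint k.
have Dm : coordwise (meas_wrt k) (grad_dev_stack k) by exact: grad_dev_stack_measurable.
have Nsq := noise_stack_sqint k.
set M := Rmx d W tau lambda k.+1; set B := lift_mx d (W k) - 1%:M.
set gam := alpha / eta.
pose p w := A k *m xhat x k w - eta *: (A k *m z k w) - alpha *: (A k *m grad_dev_stack k w).
pose r w := A k *m z k w + gam *: (B *m grad_dev_stack k w).
have M_ge0 v : 0 <= qform M v.
  by rewrite /M RmxE; apply: (lyap_ge0 htau hlambda mixing_le mixing_contr).
have M_le v : qform M v <= dot v v.
  by rewrite /M RmxE; apply: (lyap_le htau hlambda mixing_le mixing_contr).
have MA v : qform M (A k *m v) = qform (Rmx d W tau lambda k) v - del * dot v v.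
  by rewrite /M !RmxE (lyap_rec htau hlambda mixing_le mixing_contr k v) addrC addKr.
have MB v : qform M (B *m v) <= 4 * dot v v.
  apply: le_trans (M_le _) _; rewrite /B mulmxBl mul1mx.
  have H : dot (lift_mx d (W k) *m v) (lift_mx d (W k) *m v) <= dot v v.
    rewrite -[leRHS]mul1r; apply: lift_mx_bound => u; rewrite mul1r.
    exact: doubly_stochastic_le.
  have := dot_ge0 (lift_mx d (W k) *m v + v); rewrite !dotE; lra.
have det w : qform M (p w) + 2 * qform M (r w) <=
    lyapunov_value k w - del / 4 * error_energy k w
    + 5 * alpha ^+ 2 * Q / del * dot (grad_dev_stack k w) (grad_dev_stack k w).
  have Ale v : qform M (A k *m v) <= dot v v by apply: le_trans (M_le _) _; exact: mixing_le.
  have := quadratic_step M_ge0 eta_gt0 eta_le (delta_le1 lambda htau) alpha_gt0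
    (Ale (xhat x k w)) (Ale (z k w)) (Ale (grad_dev_stack k w)) (MB (grad_dev_stack k w)).
  by rewrite -/gam -/(p w) -/(r w) !MA /lyapunov_value /error_energy -/Q; lra.
have devb w : dot (grad_dev_stack k w) (grad_dev_stack k w) <=
    2 * L ^+ 2 * dot (xhat x k w) (xhat x k w) + 4 * L * (N%:R * opt_gap k w).
  have := sum_grad_dev_le hN hL hfdiff hfconvex hfsmooth xs_min (fun i => x k i w).
  rewrite -/(xbar x k w) -dot_xhat -dot_stack opt_gapE.
  by rewrite mulVKf ?gt_eqF.
pose n1 w := A k *m noise_stack k w; pose n2 w := B *m noise_stack k w.
pose cross w := (- alpha) * (bform M (p w) (n1 w) + bform M (n1 w) (p w))
  + (2 * gam) * (bform M (r w) (n2 w) + bform M (n2 w) (r w)).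
have mlin := @measurable_wrt_lin_closed R _ _ (calF k).
have p_sq : coordwise sqint p.
  apply: coordwiseB => //; last by apply: coordwiseZ => //; apply: coordwise_mulmx.
  apply: coordwiseB => //; last first.
    by apply: coordwiseZ => //; apply: coordwise_mulmx => //; exact: zvec_sqint.
  by apply: coordwise_mulmx => //; exact: xhat_sqint.
have r_sq : coordwise sqint r.
  apply: coordwiseD => //; last by apply: coordwiseZ => //; apply: coordwise_mulmx.
  by apply: coordwise_mulmx => //; exact: zvec_sqint.
have p_meas : coordwise (meas_wrt k) p.
  apply: coordwiseB => //; last by apply: coordwiseZ => //; apply: coordwise_mulmx.
  apply: coordwiseB => //; last first.
    by apply: coordwiseZ => //; apply: coordwise_mulmx => //; exact: zvec_measurable.
  by apply: coordwise_mulmx => //; exact: xhat_measurable.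
have r_meas : coordwise (meas_wrt k) r.
  apply: coordwiseD => //; last by apply: coordwiseZ => //; apply: coordwise_mulmx.
  by apply: coordwise_mulmx => //; exact: zvec_measurable.
have cent M' (B' : 'M[R]_(N * d)) u : coordwise (meas_wrt k) u -> coordwise sqint u ->
    Ex (fun w => bform M' (u w) (B' *m noise_stack k w)
      + bform M' (B' *m noise_stack k w) (u w)) = 0.
  move=> mu su; have Bn : coordwise sqint (fun w => B' *m noise_stack k w).
    exact: coordwise_mulmx.
  rewrite meanD; [|exact: bform_integ|exact: bform_integ].
  have -> : (fun w => bform M' (u w) (B' *m noise_stack k w)) =
      (fun w => bform (M' *m B') (u w) (noise_stack k w)).
    by apply/funext => w; rewrite /bform !mulmxA.
  have -> : (fun w => bform M' (B' *m noise_stack k w) (u w)) =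
      (fun w => bform (B'^T *m M') (noise_stack k w) (u w)).
    by apply/funext => w; rewrite /bform trmx_mul !mulmxA.
  have K M0 := mean_bform_centred M0 (hcalF k) mu su (@noise_stack_sqint k)
    (@noise_stack_integ k) (@noise_stack_centred k).
  by rewrite (K _).1 (K _).2 addr0.
have n1_sq : coordwise sqint n1 by exact: coordwise_mulmx.
have n2_sq : coordwise sqint n2 by exact: coordwise_mulmx.
have I1 : integ P (fun w => bform M (p w) (n1 w) + bform M (n1 w) (p w)).
  by apply: integD; exact: bform_integ.
have I2 : integ P (fun w => bform M (r w) (n2 w) + bform M (n2 w) (r w)).
  by apply: integD; exact: bform_integ.
have Icross : integ P cross by apply: integD; exact: integZ.
have Ec : Ex cross = 0.
  rewrite meanD; [|exact: integZ|exact: integZ].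
  by rewrite !meanZ // !cent // !mulr0 addr0.
have Inn : integ P (fun w => dot (noise_stack k w) (noise_stack k w)).
  by apply: bform_integ.
(* The coefficient of [|u|^2] left by [quadratic_step]. *)
pose c5 := 5 * alpha ^+ 2 * Q / del.
have c50 : 0 <= c5 by rewrite !mulr_ge0 ?invr_ge0 ?sqr_ge0 // ltW.
have [Ih Eh] := mean_comb5 (- (del / 4) + c5 * (2 * L ^+ 2)) (c5 * (4 * L * N%:R)) 1
  (alpha ^+ 2 * Q) (lyapunov_value_integ k) (error_energy_integ k) (opt_gap_integ k) Icross Inn.
have point w : lyapunov_value k.+1 w <= lyapunov_value k w
    + ((- (del / 4) + c5 * (2 * L ^+ 2)) * error_energy k w
    + (c5 * (4 * L * N%:R) * opt_gap k w
    + (1 * cross w + alpha ^+ 2 * Q * dot (noise_stack k w) (noise_stack k w)))).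
  have hE : stack (fun i => sg F xi x k i w) - stack (fun i => grad (f i) xs) =
      grad_dev_stack k w + noise_stack k w.
    rewrite stackB stackD; apply: stack_eq => i.
    by rewrite /noise [RHS]addrC addrA subrK.
  have E1 : xhat x k.+1 w = p w - alpha *: n1 w.
    rewrite (xhatS hN D hW hgt xs w eta_gt0) hE /p /n1 -/(A k).
    move: (xhat x k w) (z k w) (grad_dev_stack k w) (noise_stack k w) => v1 v2 v3 v4.
    by rewrite !mulmxBr -!scalemxAr mulmxDr scalerDr opprD addrA.
  have E2 : z k.+1 w = r w + gam *: n2 w.
    rewrite (zvecS hW hgt tau lambda grad0) hE /r /n2 -/(A k) -/B -/gam.
    move: (A k *m z k w) (grad_dev_stack k w) (noise_stack k w) => v1 v2 v3.
    by rewrite mulmxDr scalerDr addrA.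
  have N1 : qform M (n1 w) <= dot (noise_stack k w) (noise_stack k w).
    by apply: le_trans (M_le _) _; exact: mixing_le.
  have N2 := MB (noise_stack k w); rewrite -/(n2 w) in N2.
  have a2 := sqr_ge0 alpha; have g2 := sqr_ge0 gam.
  have N1' := ler_wpM2l a2 N1; have N2' := ler_wpM2l g2 N2.
  have D5 := ler_wpM2l c50 (devb w).
  have z0 : 0 <= c5 * (2 * L ^+ 2) * (2 * dot (z k w) (z k w)).
    apply: mulr_ge0; first by apply: mulr_ge0 => //; rewrite mulr_ge0 ?sqr_ge0.
    by rewrite mulr_ge0 ?dot_ge0.
  have QE : alpha ^+ 2 * Q = alpha ^+ 2 + 8 * gam ^+ 2.
    by rewrite /Qconst /gam; field; rewrite gt_eqF.
  have := det w; rewrite -/c5 => Dw.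
  rewrite {1}/lyapunov_value -/M E1 E2 QE /cross.
  move: Dw D5 N1' N2' z0; rewrite /error_energy.
  move: (p w) (r w) (n1 w) (n2 w) => p' r' m1 m2.
  rewrite !qformE !bformE.
  move: (dot (noise_stack k w) _) (dot (grad_dev_stack k w) _) (dot (xhat x k w) _)
    (dot (z k w) _) (lyapunov_value k w) (opt_gap k w) => nn dd xx zz TT gg.
  move=> *; lra.
have := le_mean (lyapunov_value_integ k.+1) Ih point; rewrite Eh Ec => H.
have N1 : 0 < N%:R^-1 :> R by rewrite invr_gt0.
have Hn := mean_noise_stack_le k.
have aQ : 0 <= alpha ^+ 2 * Q by rewrite mulr_ge0 ?sqr_ge0 // ltW.
have Hn' := ler_wpM2l aQ Hn.
have {H} : Ex (lyapunov_value k.+1) <= N%:R * (N%:R^-1 * Ex (lyapunov_value k)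
    - del / 4 * (N%:R^-1 * Ex (error_energy k))
    + 20 * alpha ^+ 2 * Q * L / del * Ex (opt_gap k)
    + 10 * alpha ^+ 2 * Q * L ^+ 2 / del * (N%:R^-1 * Ex (error_energy k))
    + alpha ^+ 2 * Q * sigma ^+ 2).
  have -> : N%:R * (N%:R^-1 * Ex (lyapunov_value k)
    - del / 4 * (N%:R^-1 * Ex (error_energy k))
    + 20 * alpha ^+ 2 * Q * L / del * Ex (opt_gap k)
    + 10 * alpha ^+ 2 * Q * L ^+ 2 / del * (N%:R^-1 * Ex (error_energy k))
    + alpha ^+ 2 * Q * sigma ^+ 2) = Ex (lyapunov_value k)
    + (- (del / 4) + c5 * (2 * L ^+ 2)) * Ex (error_energy k)
    + c5 * (4 * L * N%:R) * Ex (opt_gap k) + alpha ^+ 2 * Q * (N%:R * sigma ^+ 2).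
    by rewrite /c5; field; rewrite !gt_eqF.
  apply: le_trans H _; rewrite mulr0 add0r -!addrA lerD2l.
  by move: (_ * Ex (error_energy k)) (_ * Ex (opt_gap k)) => U V; rewrite !lerD2l.
by rewrite ler_pdivrMl.
Qed.

Lemma XtildeE k : Xtilde P xs x k = (Ex (sq_dist k))%:E.
Proof.
rewrite -expectation_mean; last exact: sq_dist_integ.
by rewrite /Xtilde; congr ('E_P[_])%E; apply/funext => w; rewrite enorm_sqr.
Qed.

Lemma FtildeE k : Ftilde D F P xs x k = (Ex (opt_gap k))%:E.
Proof. by rewrite -expectation_mean //; exact: opt_gap_integ. Qed.

Lemma EcalE k : Ecal D F xi W alpha tau lambda xs x g k =
  (N%:R^-1 * Ex (lyapunov_value k))%:E.
Proof.
by rewrite EFinM -expectation_mean //; exact: lyapunov_value_integ.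
Qed.

Lemma EtildeE k : Etilde D F xi alpha tau lambda xs x g k =
  (N%:R^-1 * Ex (error_energy k))%:E.
Proof.
rewrite EFinM -expectation_mean; last exact: error_energy_integ.
rewrite /Etilde; congr (_ * 'E_P[_])%E; apply/funext => w.
by rewrite !enorm_sqr.
Qed.

Lemma expected_recursions k :
  (Xtilde P xs x k.+1 <= Xtilde P xs x k - alpha%:E * Ftilde D F P xs x k
     + (3 * alpha * L / 2)%R%:E * Etilde D F xi alpha tau lambda xs x g k
     + (alpha ^+ 2 * sigma ^+ 2 / N%:R)%R%:E)%E /\
  (Ecal D F xi W alpha tau lambda xs x g k.+1
     <= Ecal D F xi W alpha tau lambda xs x g k
     - (del / 4)%R%:E * Etilde D F xi alpha tau lambda xs x g k
     + (20 * alpha ^+ 2 * Q * L / del)%R%:E * Ftilde D F P xs x k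
     + (10 * alpha ^+ 2 * Q * L ^+ 2 / del)%R%:E
         * Etilde D F xi alpha tau lambda xs x g k
     + (alpha ^+ 2 * Q * sigma ^+ 2)%R%:E)%E.
Proof.
rewrite !XtildeE !FtildeE !EcalE !EtildeE -!EFinM -!EFinB -!EFinD !lee_fin.
by split; [exact: mean_dist_step|exact: mean_lyap_step].
Qed.
End Estimates.

Theorem lemma4 (R : realType) (N d : nat) (hN : (0 < N)%N) (hd : (0 < d)%N)
  (* objectives *)
  (dX : 'I_N -> measure_display) (Xi : forall i, measurableType (dX i))
  (D : forall i, probability (Xi i) R)
  (F : forall i, 'cV[R]_d -> Xi i -> R)
  (hFint : forall i x, (D i).-integrable setT (EFin \o F i x))
  (hFdiff : forall i (s : Xi i) (x : 'cV[R]_d),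
     differentiable (fun y : 'cV[R]_d => F i y s : R^o) x)
  (L : R) (hL : 0 < L)
  (hfdiff : forall i (x : 'cV[R]_d),
     differentiable (fobj D F i : 'cV[R]_d -> R^o) x)
  (hfconvex : forall i,
     convex_function (setT : set 'cV[R]_d) (fobj D F i))
  (hfsmooth : forall i (x y : 'cV[R]_d),
     enorm (grad (fobj D F i) x - grad (fobj D F i) y) <= L * enorm (x - y))
  (xs : 'cV[R]_d) (hxs : forall x, favg D F xs <= favg D F x)
  (* network *)
  (W : nat -> 'M[R]_N) (hW : forall k, doubly_stochastic (W k))
  (tau : nat) (htau : (1 <= tau)%N)
  (lambda : R) (hlambda : 0 <= lambda < 1)
  (hcontr : forall k, opnorm2 (mxchain (wtilde W) (k + tau) k) <= lambda)
  (* iteration *)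
  (dO : measure_display) (Omega : measurableType dO) (P : probability Omega R)
  (xi : nat -> forall i, {RV P >-> Xi i})
  (alpha : R) (x0 : 'I_N -> 'cV[R]_d)
  (x g : nat -> 'I_N -> Omega -> 'cV[R]_d)
  (hgt : gradient_tracking F xi W alpha x0 x g)
  (* gradient noise *)
  (calF : nat -> set (set Omega)) (hcalF : forall k, sub_sigma_field (calF k))
  (hx_meas : forall k l i, (l <= k)%N -> vmeasurable_wrt (calF k) (x l i))
  (hg_meas : forall k l i, (l < k)%N -> vmeasurable_wrt (calF k) (g l i))
  (hxi_meas : forall k l i, (l < k)%N -> measurable_wrt (calF k) (xi l i))
  (hindep : forall k, cond_mutual_indep P (calF k) (fun i => xi k i : Omega -> Xi i))
  (hunbiased : forall k i (j : 'I_d),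
     is_cond_exp P (calF k) (fun w => noise D F xi x k i w j 0) (cst 0))
  (sigma : R)
  (hvar : forall k i, exists V : Omega -> R,
     is_cond_exp P (calF k) (fun w => enorm (noise D F xi x k i w) ^+ 2) V /\
     {ae P, forall w, V w <= sigma ^+ 2})
  (* stepsize *)
  (halpha : 0 < alpha <= 1 / (4 * L)) :
  let del := delta tau lambda in
  let Q := Qconst tau lambda in
  let X_ := Xtilde P xs x in
  let F_ := Ftilde D F P xs x in
  let E_ := Ecal D F xi W alpha tau lambda xs x g in
  let Et_ := Etilde D F xi alpha tau lambda xs x g in
  forall k : nat,
    (X_ k.+1 <= X_ k - alpha%:E * F_ k + (3 * alpha * L / 2)%R%:E * Et_ k
                + (alpha ^+ 2 * sigma ^+ 2 / N%:R)%R%:E)%E /\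
    (E_ k.+1 <= E_ k - (del / 4)%R%:E * Et_ k
                + (20 * alpha ^+ 2 * Q * L / del)%R%:E * F_ k
                + (10 * alpha ^+ 2 * Q * L ^+ 2 / del)%R%:E * Et_ k
                + (alpha ^+ 2 * Q * sigma ^+ 2)%R%:E)%E.
Proof.
move=> del Q X_ F_ E_ Et_ k.
by apply: (expected_recursions hN hFint hFdiff hL hfdiff hfconvex hfsmooth hxs hW
  htau hlambda hcontr hgt hcalF hx_meas hg_meas hxi_meas hindep hunbiased hvar halpha).
Qed.
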